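(* Let $(g,h)=\big(x+a_1x^2+a_2x^3+\cdots,\ c_1x+c_2\tfrac{x^2}{2}+c_3\tfrac{x^3}{3}+\cdots\big)\in G$, and write the second component of $(g,h)^{-1}$ as $d_1x+d_2\tfrac{x^2}{2}+d_3\tfrac{x^3}{3}+\cdots$. Then for every $n\ge1$, $$d_n=\sum_{\pi\in PNC(\mathtt{c}_n)}(-1)^{|\pi|}\,C_{(\overline{\pi}_+:\pi_+)}\,c_{|\pi_0|}\,a_{|\pi_1|}a_{|\pi_2|}\cdots a_{|\pi_r|},$$ where $\pi=(\pi_0,\{\pi_1,\dots,\pi_r\})$ and $|\pi|=1+r$.
   Context: $G$ is the group of pairs of formal power series $(g,h)$, $g=x+\sum_{n\ge1}a_nx^{n+1}$, $h$ with zero constant term, with product $(g_1,h_1)\cdot(g_2,h_2)=(g_1\circ g_2,\ h_1\circ g_2+h_2)$. $PNC(\mathtt{c}_n)$ is the set of pointed noncrossing partitions of the cycle $(12\dots n)$: pairs $\pi=(\pi_0,\pi_+)$ such that $\{\pi_0\}\sqcup\pi_+$ is a noncrossing partition of $[n]$ (no $a<b<c<d$ with $a,c$ in one block and $b,d$ in another); $\pi_0$ is the zero block. Adjacent closure: relabel the cycle cyclically as $(i_1\dots i_n)$ with $i_1\in\pi_0$ and order $i_1<\dots<i_n$; $\overline{\pi}_+$ is obtained from $\pi_+$ by successively merging nonzero blocks $B,B'$ whenever the maximum of $B$ is immediately followed in this order by the minimum of $B'$. $C_{(\overline{\pi}_+:\pi_+)}=\prod_{B\in\overline{\pi}_+}C_{m_B}$,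 where $m_B$ is the number of blocks of $\pi_+$ contained in $B$ and $C_m=\frac{1}{m+1}\binom{2m}{m}$. *)

(* Defs.v *)
From HB Require Import structures.
From mathcomp Require Import all_boot all_order all_algebra.
From mathcomp Require Import boolp.

Set Implicit Arguments.
Unset Strict Implicit.
Unset Printing Implicit Defensive.

Import GRing.Theory.
Local Open Scope ring_scope.

(* A formal power series over R is its sequence of coefficients; f n is the   *)
(* coefficient of x^n.                                                        *)
Definition fps (R : Type) := nat -> R.

Section PowerSeries.
Variable R : comNzRingType.
Implicit Types (f g h : fps R) (p q : {poly R}).

Definition fpsX : fps R := fun n => (n == 1%N)%:R.

Definition fps_trunc N f : {poly R} := \poly_(i < N) f i.

(* Composition f(g(x)), meaningful when g 0 = 0: the coefficient of x^n then  *)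
(* only depends on f and g modulo x^(n+1).                                    *)
Definition fps_comp f g : fps R :=
  fun n => (fps_trunc n.+1 f \Po fps_trunc n.+1 g)`_n.

(* Equality modulo x^N *)
Definition eqX N p q := forall i, (i < N)%N -> p`_i = q`_i.

Lemma eqXP N p q : eqX N p q -> exists r, p - q = r * 'X^N.
Proof.
move=> pq; exists (drop_poly N (p - q)).
rewrite -[LHS](poly_take_drop N) [take_poly _ _](_ : _ = 0) ?add0r //.
apply/polyP=> i; rewrite coef_take_poly coef0.
by case: ltnP => // iN; rewrite coefB pq // subrr.
Qed.

Lemma eqX_sym N p q : eqX N p q -> eqX N q p.
Proof. by move=> pq i iN; rewrite pq. Qed.

Lemma eqX_trans N p q r : eqX N p q -> eqX N q r -> eqX N p r.
Proof. by move=> pq qr i iN; rewrite pq // qr. Qed.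

Lemma eqX_le M N p q : (M <= N)%N -> eqX N p q -> eqX M p q.
Proof. by move=> MN pq i iM; apply/pq/(leq_trans iM). Qed.

Lemma eqX_mul N p p' q q' : eqX N p p' -> eqX N q q' -> eqX N (p * q) (p' * q').
Proof.
move=> pp qq i iN; rewrite !coefM; apply: eq_bigr => j _.
rewrite pp ?qq //; first by apply: leq_ltn_trans iN; rewrite leq_subr.
by apply: leq_ltn_trans iN; rewrite -ltnS ltn_ord.
Qed.

Lemma dvdX p : p`_0 = 0 -> exists r, p = r * 'X.
Proof.
move=> p0; have [|r] := @eqXP 1 p 0; first by move=> [|i] // _; rewrite coef0.
by rewrite subr0 expr1; exists r.
Qed.

Lemma eqX_comp N p p' q q' : q`_0 = 0 ->
  eqX N p p' -> eqX N q q' -> eqX N (p \Po q) (p' \Po q').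
Proof.
move=> q0 /eqXP[r pp] qq; apply: (@eqX_trans _ _ (p' \Po q)).
  move=> i iN; apply/eqP; rewrite -subr_eq0 -coefB -comp_polyB pp comp_polyM.
  have [s ->] := dvdX q0.
  by rewrite comp_Xn_poly exprMn mulrA coefMXn iN.
elim/poly_ind: p' {pp} => [|p' c IH]; first by rewrite !comp_poly0.
rewrite !comp_poly_MXaddC => i iN.
by rewrite !coefD (eqX_mul IH qq iN).
Qed.

Lemma coef_trunc N f i : (fps_trunc N f)`_i = if (i < N)%N then f i else 0.
Proof. exact: coef_poly. Qed.

Lemma trunc0 N f : f 0%N = 0 -> (fps_trunc N f)`_0 = 0.
Proof. by move=> f0; rewrite coef_trunc f0; case: ifP. Qed.

Lemma eqX_trunc M N f : (M <= N)%N -> eqX M (fps_trunc M f) (fps_trunc N f).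
Proof. by move=> MN i iM; rewrite !coef_trunc iM (leq_trans iM). Qed.

Lemma fps_compE N f g n : g 0%N = 0 -> (n < N)%N ->
  fps_comp f g n = (fps_trunc N f \Po fps_trunc N g)`_n.
Proof.
move=> g0 nN; apply: (@eqX_comp n.+1) => //; first exact: trunc0.
- exact: eqX_trunc.
- exact: eqX_trunc.
Qed.

Lemma eqX_fps_comp N f g : g 0%N = 0 ->
  eqX N (fps_trunc N (fps_comp f g)) (fps_trunc N f \Po fps_trunc N g).
Proof. by move=> g0 i iN; rewrite coef_trunc iN; apply: fps_compE. Qed.

Lemma fps_comp0 f g : g 0%N = 0 -> fps_comp f g 0%N = f 0%N.
Proof.
move=> g0; rewrite /fps_comp -horner_coef0 horner_comp !horner_coef0.
by rewrite coef_trunc /= g0 horner_coef0 coef_trunc.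
Qed.

Lemma fps_compA f g h : g 0%N = 0 -> h 0%N = 0 ->
  fps_comp f (fps_comp g h) = fps_comp (fps_comp f g) h.
Proof.
move=> g0 h0; apply: funext => n; rewrite {1}/fps_comp [RHS]/fps_comp.
have gh0 : fps_comp g h 0%N = 0 by rewrite fps_comp0.
rewrite -/(fps_comp g h).
have E1 := @eqX_comp n.+1 (fps_trunc n.+1 f) _ _ _ (trunc0 _ gh0)
  (fun i _ => erefl) (eqX_fps_comp g h0).
have E2 := @eqX_comp n.+1 _ _ (fps_trunc n.+1 h) _ (trunc0 _ h0)
  (eqX_fps_comp f g0) (fun i _ => erefl).
by rewrite E1 // E2 // comp_polyA.
Qed.

Lemma trunc_fpsX N : eqX N (fps_trunc N fpsX) 'X.
Proof. by move=> i iN; rewrite coef_trunc iN coefX. Qed.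

Lemma fps_compX f : fps_comp f fpsX = f.
Proof.
apply: funext => n; rewrite /fps_comp.
have -> := @eqX_comp n.+1 _ _ _ _ (trunc0 n.+1 (erefl : fpsX 0%N = 0))
  (fun i _ => erefl) (@trunc_fpsX _) n (ltnSn n).
by rewrite comp_polyXr coef_trunc ltnSn.
Qed.

Lemma fps_compXl f : f 0%N = 0 -> fps_comp fpsX f = f.
Proof.
move=> f0; apply: funext => n; rewrite /fps_comp.
have -> := @eqX_comp n.+1 _ _ _ _ (trunc0 n.+1 f0)
  (@trunc_fpsX _) (fun i _ => erefl) n (ltnSn n).
by rewrite comp_polyX coef_trunc ltnSn.
Qed.

Lemma fps_compD f1 f2 g n :
  fps_comp (fun k => f1 k + f2 k) g n = fps_comp f1 g n + fps_comp f2 g n.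
Proof.
rewrite /fps_comp -coefD -comp_polyD; congr (_ \Po _)`_n.
by apply/polyP=> i; rewrite coefD !coef_trunc; case: ifP; rewrite ?addr0.
Qed.

Lemma fps_compN f g n : fps_comp (fun k => - f k) g n = - fps_comp f g n.
Proof.
rewrite /fps_comp -coefN -raddfN; congr (_ \Po _)`_n.
by apply/polyP=> i; rewrite coefN !coef_trunc; case: ifP; rewrite ?oppr0.
Qed.

Lemma coef_comp_sum f g n : fps_comp f g n =
  \sum_(k < n.+1) f k * (fps_trunc n.+1 g ^+ k)`_n.
Proof.
rewrite /fps_comp [fps_trunc _ f]/fps_trunc poly_def (raddf_sum (comp_poly _)) coef_sum /=.
by apply: eq_bigr => k _; rewrite comp_polyZ comp_Xn_poly coefZ.
Qed.

Lemma coef_trunc_exp g n : g 0%N = 0 -> g 1%N = 1 ->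
  (fps_trunc n.+1 g ^+ n)`_n = 1.
Proof.
move=> g0 g1; set q := fps_trunc _ _; have q0 : q`_0 = 0 by rewrite trunc0.
have [s qs] := dvdX q0.
rewrite qs exprMn coefMXn ltnn subnn -horner_coef0 horner_exp horner_coef0.
case: n @q q0 qs => [|n] q q0 qs; first by rewrite expr0.
have -> : s`_0 = 1 by rewrite -[RHS]g1 -[g 1%N](coef_trunc n.+2 g 1) -/q qs coefMX.
exact: expr1n.
Qed.

(* The first n coefficients of the compositional inverse of g, obtained by    *)
(* solving f(g(x)) = x for the coefficients of f one after the other.         *)
Fixpoint fps_cinv_seq g n : seq R :=
  if n is m.+1 then
    let s := fps_cinv_seq g m in
    rcons s ((m == 1%N)%:R - \sum_(k < m) s`_k * (fps_trunc m.+1 g ^+ k)`_m)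
  else [::].

Definition fps_cinv g : fps R := fun n => (fps_cinv_seq g n.+1)`_n.

Lemma size_cinv_seq g n : size (fps_cinv_seq g n) = n.
Proof. by elim: n => //= n IH; rewrite size_rcons IH. Qed.

Lemma nth_cinv_seq g n k : (k < n)%N -> (fps_cinv_seq g n)`_k = fps_cinv g k.
Proof.
elim: n => // n IH; rewrite ltnS leq_eqVlt => /orP[/eqP-> //|kn].
by rewrite /= nth_rcons size_cinv_seq kn IH.
Qed.

Lemma fps_cinvE g n : fps_cinv g n =
  (n == 1%N)%:R - \sum_(k < n) fps_cinv g k * (fps_trunc n.+1 g ^+ k)`_n.
Proof.
rewrite {1}/fps_cinv /= nth_rcons size_cinv_seq ltnn eqxx; congr (_ - _).
by apply: eq_bigr => k _; rewrite nth_cinv_seq.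
Qed.

Lemma fps_cinvV g : g 0%N = 0 -> g 1%N = 1 -> fps_comp (fps_cinv g) g = fpsX.
Proof.
move=> g0 g1; apply: funext => n; rewrite coef_comp_sum big_ord_recr /=.
by rewrite coef_trunc_exp // mulr1 [fps_cinv g n]fps_cinvE addrC subrK.
Qed.

Lemma fps_cinv0 g : fps_cinv g 0%N = 0.
Proof. by rewrite fps_cinvE big_ord0 subr0. Qed.

Lemma fps_cinv1 g : fps_cinv g 1%N = 1.
Proof.
by rewrite fps_cinvE big_ord_recr big_ord0 /= add0r fps_cinv0 mul0r subr0.
Qed.

Lemma fps_cinvK g : g 0%N = 0 -> g 1%N = 1 -> fps_comp g (fps_cinv g) = fpsX.
Proof.
move=> g0 g1; have E := fps_cinvV (fps_cinv0 g) (fps_cinv1 g).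
suff F : fps_cinv (fps_cinv g) = g by rewrite -{1}F.
rewrite -[LHS]fps_compX -(fps_cinvV g0 g1).
by rewrite fps_compA ?fps_cinv0 // E fps_compXl.
Qed.

Lemma fps_comp1 f g : f 0%N = 0 -> g 0%N = 0 -> g 1%N = 1 ->
  fps_comp f g 1%N = f 1%N.
Proof.
move=> f0 g0 g1; rewrite coef_comp_sum !big_ord_recr big_ord0 /= f0 mul0r.
by rewrite !add0r expr1 coef_trunc /= g1 mulr1.
Qed.

(* The pairs (g, h) with g = x + O(x^2) and h = O(x).                         *)
Definition is_pspair (u : fps R * fps R) : bool :=
  [&& u.1 0%N == 0, u.1 1%N == 1 & u.2 0%N == 0].

Definition pspair_type := {u : fps R * fps R | is_pspair u}.

HB.instance Definition _ := Choice.on pspair_type.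

Implicit Types u v w : pspair_type.

Lemma pspairP u : [/\ (val u).1 0%N = 0, (val u).1 1%N = 1 & (val u).2 0%N = 0].
Proof. by case: u => u /= /and3P[/eqP ? /eqP ? /eqP ?]. Qed.

Fact pspair_one_subproof : is_pspair (fpsX, fun=> 0).
Proof. by rewrite /is_pspair /fpsX /= !eqxx. Qed.
Definition pspair_one : pspair_type := Sub (_, _) pspair_one_subproof.

Fact pspair_mul_subproof u v : is_pspair
  (fps_comp (val u).1 (val v).1,
   fun n => fps_comp (val u).2 (val v).1 n + (val v).2 n).
Proof.
have [g0 g1 h0] := pspairP u; have [k0 k1 l0] := pspairP v.
apply/and3P; split; apply/eqP => /=.
- by rewrite fps_comp0.
- by rewrite fps_comp1.
- by rewrite fps_comp0 // h0 l0 addr0.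
Qed.
Definition pspair_mul u v : pspair_type := Sub (_, _) (pspair_mul_subproof u v).

Fact pspair_inv_subproof u : is_pspair
  (fps_cinv (val u).1, fun n => - fps_comp (val u).2 (fps_cinv (val u).1) n).
Proof.
have [g0 g1 h0] := pspairP u.
apply/and3P; split; apply/eqP => /=.
- exact: fps_cinv0.
- exact: fps_cinv1.
- by rewrite fps_comp0 ?fps_cinv0 // h0 oppr0.
Qed.
Definition pspair_inv u : pspair_type := Sub (_, _) (pspair_inv_subproof u).

Lemma pspair_mulA : associative pspair_mul.
Proof.
move=> u v w; have [g0 g1 h0] := pspairP u; have [k0 k1 l0] := pspairP v.
have [m0 m1 n0] := pspairP w.
apply: val_inj => /=; congr (_, _); first by rewrite fps_compA.
by apply: funext => n; rewrite fps_compA // fps_compD addrA.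
Qed.

Lemma pspair_mul1 : left_id pspair_one pspair_mul.
Proof.
move=> u; have [g0 g1 h0] := pspairP u.
apply: val_inj; rewrite [RHS]surjective_pairing /=; congr (_, _).
  by rewrite fps_compXl.
apply: funext => n; rewrite coef_comp_sum big1 ?add0r // => i _.
by rewrite mul0r.
Qed.

Lemma pspair_mulr1 : right_id pspair_one pspair_mul.
Proof.
move=> u; apply: val_inj; rewrite [RHS]surjective_pairing /=.
by rewrite !fps_compX; congr (_, _); apply: funext => n; rewrite addr0.
Qed.

Lemma pspair_mulV : right_inverse pspair_one pspair_inv pspair_mul.
Proof.
move=> u; have [g0 g1 h0] := pspairP u; apply: val_inj => /=; congr (_, _).
  exact: fps_cinvK.
by apply: funext => n; rewrite subrr.
Qed.

Lemma pspair_mulVl : left_inverse pspair_one pspair_inv pspair_mul.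
Proof.
move=> u; have [g0 g1 h0] := pspairP u; apply: val_inj => /=; congr (_, _).
  exact: fps_cinvV.
apply: funext => n; rewrite fps_compN -fps_compA ?fps_cinv0 //.
by rewrite fps_cinvV // fps_compX addNr.
Qed.

HB.instance Definition _ := isGroup.Build pspair_type
  pspair_mulA pspair_mul1 pspair_mulr1 pspair_mulVl pspair_mulV.

End PowerSeries.

(* The group G over R; its product, identity and inverse are those of         *)
(* group_scope.                                                               *)
Definition pspair (R : comNzRingType) : groupType := pspair_type R.

Section PointedNoncrossing.
Variable n : nat.
Implicit Types (A B Z : {set 'I_n}) (P : {set {set 'I_n}}).

(* The points 1, ..., n are encoded as 0, ..., n-1.                           *)
Definition noncrossing P : bool :=
  [forall A in P, forall B in P, (A != B) ==>
    [forall a in A, forall b in B, forall c in A, forall d in B,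
      ~~ [&& (a < b)%N, (b < c)%N & (c < d)%N]]].

Definition PNC : {set {set 'I_n} * {set {set 'I_n}}} :=
  [set p : {set 'I_n} * {set {set 'I_n}} | [&& p.1 \notin p.2,
               partition (p.1 |: p.2) [set: 'I_n] & noncrossing (p.1 |: p.2)]].

(* Position of j, counted from 0, when the cycle is read starting at z.       *)
Definition cpos (z j : 'I_n) : nat := ((j + (n - z)) %% n)%N.

(* In the linear order starting at z, the maximum of A is immediately         *)
(* followed by the minimum of B.                                              *)
Definition adjacent (z : 'I_n) A B : bool :=
  [exists j in A, exists k in B,
    [&& [forall i in A, cpos z i <= cpos z j]%N,
        [forall i in B, cpos z k <= cpos z i]%N
      & cpos z k == (cpos z j).+1]].

Definition merge_step (z : 'I_n) P : {set {set 'I_n}} :=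
  if [pick AB | [&& AB.1 \in P, AB.2 \in P & adjacent z AB.1 AB.2]]
    is Some (A, B) then (A :|: B) |: (P :\ A :\ B) else P.

(* #|P| steps are enough to reach a partition without adjacent blocks, since  *)
(* each effective merge decreases the number of blocks.                       *)
Definition adjacent_closure (z : 'I_n) P : {set {set 'I_n}} :=
  iter #|P| (merge_step z) P.

End PointedNoncrossing.

Definition catalan m : nat := ('C(m.*2, m) %/ m.+1)%N.

(* C_(Q : P) for a partition P refining Q *)
Definition Crel n (Q P : {set {set 'I_n}}) : nat :=
  (\prod_(B in Q) catalan #|[set A in P | A \subset B]|)%N.

(* Main.v *)
Require Import Defs.
From mathcomp Require Import all_boot all_order all_algebra.
From mathcomp Require Import zify.

Set Implicit Arguments.
Unset Strict Implicit.
Unset Printing Implicit Defensive.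

Import GRing.Theory.

(* With w the compositional inverse of g, the second component of the inverse *)
(* pair is - h(w), so it suffices to show that k times the weighted sum over  *)
(* the partitions with |pi_0| = k is n [x^n] w^k.  Choosing a base point z in *)
(* pi_0 replaces this sum by n sums over partitions with a fixed z in pi_0.   *)
(* For fixed z, let E(q, k) be the sum over the partitions whose zero block   *)
(* has k points and contains the first q points read from z.  The relation    *)
(* w + sum_b a_b w^(b+1) = x gives E(q, k) = [x^(n-q+1)] w^(k-q+1) as soon as *)
(*   E(q, k) = E(q+1, k) - sum_b a_b E(q, k + b).                             *)
(* If the point number q is not in pi_0, its adjacency chain consists of the  *)
(* m blocks maximal in the gap of pi_0 starting there.  Moving the (i+1)-st   *)
(* of them into pi_0 leaves chains of i and m-1-i blocks, so the recurrence   *)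
(* C_m = sum_i C_i C_(m-1-i) distributes the weight over these moves.  A move *)
(* is undone by extracting from the zero block its points number q,..,q+b-1.  *)

(** * Catalan numbers *)

(** The second component of the inverse is [- h(w)] for [w = fps_cinv g], so d_n / n is minus the
    sum over k of (c_k / k) [x^n] w^k. The formula follows once k W_k = n [x^n] w^k, where W_k is
    the sum of [wt] over the partitions with k points in the zero block; [Crel_closure] says that
    [wt] carries the right Catalan factor.

    Counting pairs of a partition and a point of its zero block writes k W_k as a sum over n base
    points ([sum_wt]); the weight is the same for every such base point ([adjacent_rebase]). Each of
    the n sums equals [x^n] w^k ([wt_sum_inverse]), since both sides obey one recurrence with the
    same boundary values ([wt_sum_coef]). For the coefficients it is g(w) = x multiplied by a power
    of w ([cinv_exp_rec]). For the partitions ([wt_sum_rec]) it has two sources: moving a maximal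
    block of the first gap into the zero block is a bijection ([gap_move_inj], [gap_move_onto]), and
    the Catalan recurrence shares out the weight of a partition among its possible moves
    ([chain_weight_split]). *)

Lemma mul_catalan m : (m.+1 * catalan m = 'C(m.*2, m))%N.
Proof.
rewrite /catalan mulnC divnK //.
have E : (m.+1 * 'C(m.*2, m.+1) = m * 'C(m.*2, m))%N.
  by rewrite mul_bin_left -addnn addnK.
(* The cofactor is the Catalan number as a difference of binomials; it shows that the truncated
   division in [catalan] is exact. *)
have -> : 'C(m.*2, m) = (m.+1 * ('C(m.*2, m) - 'C(m.*2, m.+1)))%N.
  by rewrite mulnBr E mulSn addnK.
exact: dvdn_mulr.
Qed.

Lemma catalanS m : (m.+2 * catalan m.+1 = (m.*2.+1).*2 * catalan m)%N.
Proof.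
apply/eqP; rewrite -(eqn_pmul2l (ltn0Sn m)); apply/eqP.
rewrite mul_catalan mulnCA mul_catalan.
have E1 : (m.+1 * 'C(m.*2.+2, m.+1) = m.*2.+2 * 'C(m.*2.+1, m))%N.
  by rewrite mul_bin_diag.
have E2 : (m.+1 * 'C(m.*2.+1, m) = m.*2.+1 * 'C(m.*2, m))%N.
  have := mul_bin_down m.*2.+1 m.
  by rewrite -pred_Sn -addnn; move=> ->; congr (_ * _)%N; lia.
rewrite doubleS E1; lia.
Qed.

Definition catconv n := (\sum_(i < n.+1) catalan i * catalan (n - i))%N.

(** The reversal of i and n - i preserves each product, so the factor i averages to n/2. *)
Lemma catconv_weighted n :
  (2 * \sum_(i < n.+1) i * (catalan i * catalan (n - i)) = n * catconv n)%N.
Proof.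
rewrite mul2n -addnn {2}(reindex_inj rev_ord_inj) -big_split /= /catconv big_distrr /=.
apply: eq_bigr => i _; have := ltn_ord i => ?.
rewrite subSS subKn // [(catalan (n - i) * _)%N]mulnC -mulnDl; congr (_ * _)%N; lia.
Qed.

(* (i+1) C_i = (4i-2) C_(i-1) turns the symmetrized sum of                   *)
(* (i+1) C_i C_(n-i) into a convolution of order n-1.                         *)
Lemma catalan_rec n : catconv n = catalan n.+1.
Proof.
elim: n => [|n IH]; first by rewrite /catconv big_ord1.
apply/eqP; rewrite -(eqn_pmul2l (ltn0Sn n.+2)) catalanS; apply/eqP.
have E : (n.+3 * catconv n.+1 = 2 * \sum_(i < n.+2) i.+1 * catalan i * catalan (n.+1 - i))%N.
  under eq_bigr => i _ do rewrite -mulnA mulSn.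
  by rewrite big_split /= mulnDr catconv_weighted -/(catconv _); lia.
rewrite E big_ord_recl /= subn0.
under eq_bigr => i _ do rewrite /bump add1n subSS catalanS.
have -> : (\sum_(i < n.+1) (i.*2.+1).*2 * catalan i * catalan (n - i) =
  2 * (2 * \sum_(i < n.+1) i * (catalan i * catalan (n - i))) + 2 * catconv n)%N.
  rewrite !big_distrr -big_split /=; apply: eq_bigr => i _; lia.
rewrite catconv_weighted IH /catalan /= -/(catalan n.+1).
rewrite divnn /=; nia.
Qed.

(** * Chains of a relation that is a disjoint union of paths *)

Section Chains.
Variables (T : finType) (e : rel T).
Implicit Types (P Q : {set T}) (x y : T) (s : seq T).

Definition restr P : rel T := [rel x y | [&& x \in P, y \in P & e x y]].
Definition reach P x : {set T} := [set y | connect (restr P) x y].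
Definition heads P : {set T} := [set x in P | [forall y in P, ~~ e y x]].
(* For e the adjacency of blocks this is the factor C of the adjacent         *)
(* closure, see Crel_closure; being defined on the blocks themselves, it does *)
(* not depend on the order in which they get merged.                          *)
Definition chain_weight P : nat := \prod_(x in heads P) catalan #|reach P x|.

Definition chain P x s :=
  path (restr P) x s /\ forall y, ~~ restr P (last x s) y.

Variable rank : T -> nat.

(** Unique successors, unique predecessors and a rank that excludes cycles: on [P] the relation is a
    disjoint union of paths. *)
Definition path_like P := [/\ {in P & &, forall x y y', e x y -> e x y' -> y = y'},
  {in P & &, forall y x x', e x y -> e x' y -> x = x'}
  & {in P &, forall x y, e x y -> rank x < rank y}].

Lemma path_like_sub P Q : Q \subset P -> path_like P -> path_like Q.
Proof.
move=> /subsetP QP [f i r]; split.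
- by move=> x y y' /QP xP /QP yP /QP; apply: f.
- by move=> x y y' /QP xP /QP yP /QP; apply: i.
by move=> x y /QP xP /QP; apply: r.
Qed.

Section PathLike.
Variable P : {set T}.
Hypothesis linP : path_like P.

Let funE x y y' : restr P x y -> restr P x y' -> y = y'.
Proof. by case: linP => f _ _ /and3P[xP yP xy] /and3P[_ yP' xy']; apply: (f x). Qed.

Let injE y x x' : restr P x y -> restr P x' y -> x = x'.
Proof. by case: linP => _ f _ /and3P[xP yP xy] /and3P[xP' _ xy']; apply: (f y). Qed.

Let rankE x y : restr P x y -> rank x < rank y.
Proof. by case: linP => _ _ f /and3P[xP yP xy]; apply: f. Qed.

Lemma chain_ex x : exists s, chain P x s.
Proof.
have [m] := ubnP (\max_y rank y - rank x).
elim: m x => // m IH x xm.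
have [y xy|nxy] := pickP (restr P x); last first.
  by exists [::]; split => // y; rewrite nxy.
have [|s [ps ls]] := IH y; last by exists (y :: s); split; rewrite //= xy.
have := rankE xy; have : rank y <= \max_y rank y by apply: leq_bigmax.
lia.
Qed.

Lemma path_rank x s : path (restr P) x s -> path ltn (rank x) (map rank s).
Proof. by elim: s x => //= y s IH x /andP[/rankE -> /IH]. Qed.

Lemma path_uniq x s : path (restr P) x s -> uniq (x :: s).
Proof.
move=> /path_rank ps; apply: (@map_uniq _ _ rank).
exact: (sorted_uniq ltn_trans ltnn).
Qed.

Lemma path_sub x s : x \in P -> path (restr P) x s -> {subset x :: s <= P}.
Proof.
elim: s x => /= [|y s IH] x xP; first by move=> _ z; rewrite inE => /eqP->.
move=> /andP[/and3P[_ yP _] /(IH _ yP)] sub z; rewrite inE => /orP[/eqP-> //|].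
exact: sub.
Qed.

Lemma reach_chain x s : chain P x s -> reach P x = [set y in x :: s].
Proof.
move=> [ps ls]; apply/setP => y; rewrite !inE -in_cons; apply/idP/idP; last first.
  by move=> ys; apply: (path_connect ps).
case/connectP => t; elim: t x s ps ls => /= [|x' t IH] x s ps ls.
  by move=> _ ->; rewrite mem_head.
case/andP=> xx'; case: s ps ls => [_ /(_ x')|x2 s /= /andP[xx2 ps] ls].
  by rewrite xx'.
rewrite (funE xx' xx2) in_cons => pt yl; apply/orP; right; exact: (IH x2 s).
Qed.

Lemma card_reach x s : chain P x s -> #|reach P x| = (size s).+1.
Proof.
by move=> c; rewrite (reach_chain c) cardsE (card_uniqP (path_uniq c.1)).
Qed.

Lemma head_path x s y : x \in heads P -> y \in x :: s -> path (restr P) x s ->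
  y \in heads P -> y = x.
Proof.
move=> xh; rewrite inE => /orP[/eqP // |].
elim: s x xh => // z s IH x xh; rewrite inE => ys /= /andP[xz ps] yh.
case/orP: ys => [/eqP yz|ys].
  case/and3P: xz => xP _; rewrite -yz; move: yh; rewrite inE => /andP[_ /forall_inP/(_ _ xP)].
  by move=> /negP.
have yrs : exists2 y', y' \in P & e y' y.
  case/splitPr: ys ps => p1 p2; rewrite cat_path /= => /and3P[_ /and3P[]].
  by move=> ? _ ? _; eexists; eauto.
case: yrs => y' yP' yy'; move: yh; rewrite inE => /andP[_ /forall_inP/(_ _ yP')].
by rewrite yy'.
Qed.

Lemma reach_heads_disj x x' y : x \in heads P -> x' \in heads P ->
  y \in reach P x -> y \in reach P x' -> x = x'.
Proof.
rewrite !inE => /andP[xP /forall_inP hx] /andP[xP' /forall_inP hx'].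
case/connectP => s; elim/last_ind: s y => [|s y1 IH] y /=.
  move=> _ -> /connectP[s']; case/lastP: s' => //= s' y'.
  rewrite rcons_path last_rcons => /andP[_ /and3P[lP _ le]] E.
  by move: (hx _ lP); rewrite E le.
rewrite rcons_path last_rcons => /andP[ps ly] ->.
case/connectP => s'; case/lastP: s' => [_ E|s' y'] /=.
  by case/and3P: ly => lP _; rewrite E => le; move: (hx' _ lP); rewrite le.
rewrite rcons_path last_rcons => /andP[ps' ly'] E; rewrite -E in ly'.
apply: (IH _ ps erefl); rewrite (injE ly ly'); apply/connectP; by exists s'.
Qed.

End PathLike.

Lemma restr_rem P b x y : x != b -> y != b -> restr (P :\ b) x y = restr P x y.
Proof. by move=> xb yb; rewrite /restr /= !inE xb yb. Qed.

Lemma path_rem P b x s : b \notin x :: s ->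
  path (restr (P :\ b)) x s = path (restr P) x s.
Proof.
elim: s x => //= y s IH x; rewrite !inE !negb_or => /and3P[bx by' bs].
rewrite IH ?inE ?negb_or ?by' //; congr (_ && _).
by apply: restr_rem; rewrite eq_sym.
Qed.

Lemma restr_remW P b x y : restr (P :\ b) x y -> restr P x y.
Proof. by case/and3P => /setD1P[_ xP] /setD1P[_ yP] xy; apply/and3P. Qed.

Lemma prod_set_of_seq s (F : T -> nat) : uniq s ->
  \prod_(x in [set y in s]) F x = \prod_(x <- s) F x.
Proof. by move=> us; rewrite big_uniq //=; apply: eq_bigl => x; rewrite inE. Qed.

Lemma sum_set_of_seq s (F : T -> nat) : uniq s ->
  \sum_(x in [set y in s]) F x = \sum_(x <- s) F x.
Proof. by move=> us; rewrite big_uniq //=; apply: eq_bigl => x; rewrite inE. Qed.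

Lemma restr_rem_pred P b x y : path_like P -> restr P x b -> ~~ restr (P :\ b) x y.
Proof.
move=> [f _ _] /and3P[xP bP xb]; apply/negP => /and3P[_ /setD1P[yb yP] xy].
by move: yb; rewrite (f x y b) ?eqxx.
Qed.

Lemma chain_remW P b x s : b \notin x :: s -> chain P x s -> chain (P :\ b) x s.
Proof.
move=> bs [ps ls]; split; first by rewrite path_rem.
by move=> y; apply: contra (ls y); apply: restr_remW.
Qed.

(** Removing [b] cuts its chain into the pieces [s1] and [s2] and leaves all other chains as they
    are. An empty piece contributes [catalan 0], which is 1. *)
Lemma chain_weight_rem P x s s1 b s2 : path_like P -> x \in heads P ->
  chain P x s -> x :: s = s1 ++ b :: s2 ->
  chain_weight (P :\ b) = catalan (size s1) * catalan (size s2)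
    * \prod_(y in heads P :\ x) catalan #|reach P y|.
Proof.
move=> lP xh cxs E.
have lP' : path_like (P :\ b) by apply: path_like_sub lP; apply: subsetDl.
have xP : x \in P by move: xh; rewrite inE => /andP[].
have us := path_uniq lP cxs.1; have sub := path_sub xP cxs.1.
have bP : b \in P by apply: sub; rewrite E mem_cat mem_head orbT.
have bx : b \in reach P x by rewrite (reach_chain lP cxs) inE E mem_cat mem_head orbT.
rewrite /chain_weight (big_setID (heads P :\ x)) /= mulnC; congr (_ * _); last first.
  have -> : heads (P :\ b) :&: (heads P :\ x) = heads P :\ x.
    apply/setIidPr/subsetP => y /setD1P[yx yh].
    have yb : y != b.
      apply: contra yx => /eqP yb; apply/eqP.
      by apply: (@head_path P x s) => //; [rewrite yb E mem_cat mem_head orbT | case: cxs].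
    move: yh; rewrite !inE yb => /andP[-> /forall_inP hy] /=.
    by apply/forall_inP => v /setD1P[_]; apply: hy.
  apply: eq_bigr => y /setD1P[yx yh]; congr catalan.
  have [s' cy] := chain_ex lP y.
  have bs' : b \notin y :: s'.
    apply: contra yx => bs'; apply/eqP; apply: (@reach_heads_disj P lP y x b) => //.
    by rewrite (reach_chain lP cy) inE.
  by rewrite (card_reach lP' (chain_remW bs' cy)) (card_reach lP cy).
(* [take 1] is the first element of a piece, or nothing if the piece is empty. A new head either was
   the head [x] itself or has lost its only predecessor [b]. *)
have -> : heads (P :\ b) :\: (heads P :\ x) = [set y in take 1 s1 ++ take 1 s2].
  apply/setP => y; rewrite !inE mem_cat; apply/idP/idP.
    case/and3P=> nO /andP[yb yP] /forall_inP hy.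
    case: (boolP [forall y0 in P, ~~ e y0 y]) nO => [hP|].
      rewrite yP !andbT negbK => /eqP yx; rewrite yx in yb.
      case: (s1) E => [[xb _]|z s1' [xz _]]; first by rewrite xb eqxx in yb.
      by rewrite /= take0 yx xz mem_head.
    case/forall_inPn => v vP /negPn vy _; case: (eqVneq v b) => [vb|vb]; last first.
      by have := hy v; rewrite !inE vb vP vy => /(_ isT).
    rewrite {v vP}vb in vy; have by' : restr P b y by apply/and3P.
    case: cxs => ps ls.
    have : last x s = last b s2 by rewrite -[last x s]/(last x (x :: s)) E last_cat.
    case: (s2) E => [|y' s2'] E /= lE.
      by have := ls y; rewrite lE by'.
    have : path (restr P) b (y' :: s2').
      by case: (s1) E ps => [[-> ->] //|? ? [_ ->]]; rewrite cat_path => /andP[_ /andP[]].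
    case/andP=> /and3P[_ yP' by'2] _; case: lP => f _ _.
    by rewrite (f b y y') // take0 mem_head orbT.
  case/orP.
    case: (s1) E us => [//|z s1' [<- ->]] /=; rewrite take0 inE => /andP[xs _] /eqP->.
    rewrite eqxx xP /= andbT; move: xs; rewrite mem_cat in_cons !negb_or => /and3P[_ xb _].
    rewrite xb /=; apply/forall_inP => v /setD1P[_ vP].
    by move: xh; rewrite inE => /andP[_ /forall_inP]; apply.
  case: (s2) E us => [//|z s2'] E us; rewrite /= take0 inE => /eqP->.
  have : path (restr P) b (z :: s2').
    by case: cxs => ps _; case: (s1) E ps => [[-> ->] //|? ? [_ ->]];
       rewrite cat_path => /andP[_ /andP[]].
  case/andP=> /and3P[_ zP bz] _; rewrite zP /= andbT.
  have zb : z != b.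
    apply/eqP => zb; move: us; rewrite E cat_uniq /= => /and3P[_ _ /andP[]].
    by rewrite zb mem_head.
  rewrite zb /=; apply/andP; split.
    rewrite negb_and; apply/orP; right; apply/negP => /forall_inP/(_ b bP).
    by rewrite bz.
  apply/forall_inP => v /setD1P[vb vP]; apply/negP => vz; case: lP => _ i _.
  by move: vb; rewrite (i z v b) ?eqxx.
have u2 : uniq (take 1 s1 ++ take 1 s2).
  apply: subseq_uniq us; rewrite E; apply: cat_subseq; first exact: take_subseq.
  exact: subseq_trans (take_subseq _ _) (subseq_cons _ _).
rewrite (prod_set_of_seq _ u2) big_cat /=; congr (_ * _).
  case: (s1) E us => [_ _|z s1' [<- Es]]; first by rewrite big_nil.
  rewrite /= take0 big_seq1 => /andP[xs us]; congr catalan.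
  rewrite Es in xs us *; move: cxs; rewrite Es => -[].
  rewrite cat_path /= => /and3P[ps1 l1b _] _; apply: card_reach => //; split.
    by rewrite path_rem // in_cons negb_or; move: xs us;
       rewrite mem_cat in_cons cat_uniq !negb_or => /and3P[_ xb _] /and3P[_ /andP[? _] _];
       rewrite eq_sym xb.
  by move=> y; apply: restr_rem_pred.
case: (s2) E us => [_ _|z s2' E]; first by rewrite big_nil.
rewrite E /= take0 big_seq1 cat_uniq => /and3P[_ _ /andP[bs2 _]]; congr catalan.
apply: (card_reach lP'); apply: chain_remW => //.
case: cxs => ps ls; split.
  by case: (s1) E ps => [[-> ->] /andP[] //|? ? [_ ->]];
     rewrite cat_path => /and3P[_ _ /andP[]].
suff -> : last z s2' = last x s by [].
by have := congr1 (last x) E; rewrite last_cat /= => ->.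
Qed.

(** For a chain of m elements, removing the one at index i replaces the factor C_m by C_i C_(m-1-i);
    summing over i is the Catalan recurrence. *)
Lemma chain_weight_split P x : path_like P -> x \in heads P ->
  \sum_(b in reach P x) chain_weight (P :\ b) = chain_weight P.
Proof.
move=> lP xh; have [s cxs] := chain_ex lP x.
rewrite (reach_chain lP cxs) (sum_set_of_seq _ (path_uniq lP cxs.1)).
rewrite [in RHS]/chain_weight (big_setD1 x xh) /= (card_reach lP cxs) -catalan_rec.
rewrite /catconv big_distrl /=.
rewrite (big_nth x) big_mkord; apply: eq_bigr => i _.
have ilt : i < size (x :: s) by [].
have E : x :: s = take i (x :: s) ++ nth x (x :: s) i :: drop i.+1 (x :: s).
  by rewrite -drop_nth // cat_take_drop.
by rewrite (chain_weight_rem lP xh cxs E) size_takel 1?ltnW // size_drop.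
Qed.

End Chains.

(** * Blocks on the cycle read from a base point *)

Local Ltac leq_cases := repeat match goal with
  |- context [if (?a <= ?b) then _ else _] => case: (leqP a b) => ? end; lia.

Lemma eq_chain_weight (T : finType) (e e' : rel T) (P : {set T}) :
  {in P &, e =2 e'} -> chain_weight e P = chain_weight e' P.
Proof.
move=> ee'; have re x y : restr e P x y = restr e' P x y.
  by rewrite /restr /=; case: (boolP (x \in P)) => // xP; case: (boolP (y \in P)) => //= yP;
     rewrite ee'.
have -> : chain_weight e P = \prod_(x in heads e' P) catalan #|reach e P x|.
  apply: eq_bigl => x; rewrite !inE; apply: andb_id2l => xP.
  by apply/forall_inP/forall_inP => h y yP; rewrite ?ee' ?h // -ee' ?h.
apply: eq_bigr => x _; congr catalan; apply: eq_card => y.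
by rewrite !inE (eq_connect re).
Qed.

Section Positions.
Variable n : nat.
Implicit Types (z i j : 'I_n) (A B K : {set 'I_n}) (P Q : {set {set 'I_n}}).

Lemma cposE z j : cpos z j = if z <= j then j - z else j + n - z.
Proof.
have := ltn_ord z; have := ltn_ord j; rewrite /cpos => jn zn.
case: leqP => zj; last by rewrite modn_small; lia.
have -> : j + (n - z) = n + (j - z) by lia.
by rewrite modnDl modn_small; lia.
Qed.

Lemma cpos_lt z j : cpos z j < n.
Proof. by rewrite ltn_mod; case: n z => // -[]. Qed.

Lemma cpos_inj z : injective (cpos z).
Proof.
move=> i j; rewrite !cposE => E; apply: val_inj => /=.
have := ltn_ord z; have := ltn_ord j; have := ltn_ord i; move: E.
leq_cases.
Qed.

Lemma cpos_self z : cpos z z = 0.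
Proof. by rewrite cposE leqnn subnn. Qed.

Lemma cpos_surj z m : m < n -> exists j, cpos z j = m.
Proof.
move=> minpos; have ltzm : (if m + z < n then m + z else m + z - n) < n.
  by have := ltn_ord z; case: (ltnP (m + z) n); lia.
exists (Ordinal ltzm); rewrite cposE /=; have := ltn_ord z.
by case: (ltnP (m + z) n) => ?; leq_cases.
Qed.

Definition disj P := forall A B i, A \in P -> B \in P -> i \in A -> i \in B -> A = B.
(** A partition without the covering condition, so that it passes to subfamilies such as the nonzero
    blocks. *)
Definition blocks P := disj P /\ forall A, A \in P -> exists i, i \in A.

Lemma blocks_sub P Q : Q \subset P -> blocks P -> blocks Q.
Proof.
move=> /subsetP s [d ne]; split; last by move=> A /s; apply: ne.
by move=> A B i /s AP /s; apply: d.
Qed.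

Lemma partition_blocks P : partition P [set: 'I_n] -> blocks P.
Proof.
case/and3P=> _ /trivIsetP tI P0; split=> [A B i AP BP iA iB|A AP].
  apply/eqP/negPn/negP => AB; have := tI _ _ AP BP AB.
  by rewrite disjoint_sym => /disjointFr/(_ iB); rewrite iA.
by apply/set0Pn; apply: contraNneq P0 => <-.
Qed.

Lemma partition_mem P i : partition P [set: 'I_n] -> exists2 A, A \in P & i \in A.
Proof.
case/and3P=> /eqP cP _ _; have : i \in cover P by rewrite cP inE.
by case/bigcupP => A; exists A.
Qed.

Lemma blocks_partition P : blocks P -> (forall i, exists2 A, A \in P & i \in A) ->
  partition P [set: 'I_n].
Proof.
move=> [d ne] c; apply/and3P; split.
- apply/eqP/setP => i; rewrite inE; have [A AP iA] := c i.
  by apply/bigcupP; exists A.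
- apply/trivIsetP => A B AP BP /eqP AB; rewrite -setI_eq0; apply/eqP/setP => i.
  by rewrite !inE; apply/negP => /andP[iA iB]; apply: AB; apply: (d A B i).
by apply/negP => /ne[i]; rewrite inE.
Qed.

Definition nc z P := forall A B, A \in P -> B \in P -> A <> B ->
  forall a b c d, a \in A -> b \in B -> c \in A -> d \in B ->
  ~ [/\ cpos z a < cpos z b, cpos z b < cpos z c & cpos z c < cpos z d].

(** Crossing is a cyclic notion: changing where the cycle is cut rotates a crossing quadruple, and a
    rotation by an odd number of places only exchanges the roles of [A] and [B]. *)
Lemma noncrossingP z P : reflect (nc z P) (noncrossing P).
Proof.
apply: (iffP idP) => [ncP A B AP BP AB a b c d aA bB cA dB [ab bc cd]|ncP].
  have H A' B' : A' \in P -> B' \in P -> A' <> B' -> forall a' b' c' d',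
      a' \in A' -> b' \in B' -> c' \in A' -> d' \in B' ->
      [&& (a' < b')%N, (b' < c')%N & (c' < d')%N] = false.
    move=> A'P B'P /eqP A'B' a' b' c' d' a'A b'B c'A d'B; apply: negbTE.
    move: ncP => /forall_inP/(_ _ A'P)/forall_inP/(_ _ B'P)/implyP/(_ A'B').
    move=> /forall_inP/(_ _ a'A)/forall_inP/(_ _ b'B).
    by move=> /forall_inP/(_ _ c'A)/forall_inP/(_ _ d'B).
  have BA := nesym AB.
  suff : [|| [&& a < b, b < c & c < d], [&& b < c, c < d & d < a],
             [&& c < d, d < a & a < b] | [&& d < a, a < b & b < c]].
    by rewrite (H A B) // (H B A) // (H A B) // (H B A).
  move: ab bc cd; rewrite !cposE; clear.
  have := ltn_ord z; have := ltn_ord a; have := ltn_ord b.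
  have := ltn_ord c; have := ltn_ord d.
  move: {a b c d z} (val z) (val a) (val b) (val c) (val d) => z a b c d.
  leq_cases.
apply/forall_inP => A AP; apply/forall_inP => B BP; apply/implyP => /eqP AB.
apply/forall_inP => a aA; apply/forall_inP => b bB.
apply/forall_inP => c cA; apply/forall_inP => d dB.
apply/negP => /and3P[ab bc cd]; have BA := nesym AB.
have : [|| [&& cpos z a < cpos z b, cpos z b < cpos z c & cpos z c < cpos z d],
           [&& cpos z b < cpos z c, cpos z c < cpos z d & cpos z d < cpos z a],
           [&& cpos z c < cpos z d, cpos z d < cpos z a & cpos z a < cpos z b]
         | [&& cpos z d < cpos z a, cpos z a < cpos z b & cpos z b < cpos z c]].
  move: ab bc cd; rewrite !cposE.
  have := ltn_ord z; have := ltn_ord a; have := ltn_ord b.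
  have := ltn_ord c; have := ltn_ord d; clear.
  move: {a b c d z} (val z) (val a) (val b) (val c) (val d) => z a b c d.
  leq_cases.
case/or4P => /and3P[h1 h2 h3].
- exact: (ncP _ _ AP BP AB a b c d).
- exact: (ncP _ _ BP AP BA b c d a).
- exact: (ncP _ _ AP BP AB c d a b).
exact: (ncP _ _ BP AP BA d a b c).
Qed.

Section Base.
Variable z : 'I_n.
Local Notation pos := (cpos z).
Local Notation adj := (adjacent z).

Definition maxpos A := \max_(i in A) pos i.
(** The minimum is expressed through a maximum, whose neutral element 0 gives the empty set the
    value [n]. *)
Definition minpos A := n - \max_(i in A) (n - pos i).

Lemma maxpos_ge A i : i \in A -> pos i <= maxpos A.
Proof. by move=> iA; rewrite /maxpos (bigD1 i) //= leq_maxl. Qed.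

Lemma maxpos_ex A i : i \in A -> exists2 j, j \in A & pos j = maxpos A.
Proof.
move=> iA; have [|j jA E] := @eq_bigmax_cond _ (mem A) pos; last by exists j.
by apply/card_gt0P; exists i.
Qed.

Lemma minpos_le A i : i \in A -> minpos A <= pos i.
Proof.
move=> iA; have : n - pos i <= \max_(i in A) (n - pos i) by rewrite (bigD1 i) //= leq_maxl.
by rewrite /minpos; have := cpos_lt z i; lia.
Qed.

Lemma minpos_ex A i : i \in A -> exists2 j, j \in A & pos j = minpos A.
Proof.
move=> iA; have [|j jA E] := @eq_bigmax_cond _ (mem A) (fun i => n - pos i); last first.
  by exists j => //; rewrite /minpos E; have := cpos_lt z j; lia.
by apply/card_gt0P; exists i.
Qed.

Lemma maxpos_eq A j : j \in A -> (forall i, i \in A -> pos i <= pos j) -> maxpos A = pos j.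
Proof.
move=> jA h; have [k kA E] := maxpos_ex jA.
by have := h k kA; have := maxpos_ge jA; lia.
Qed.

Lemma minpos_eq A j : j \in A -> (forall i, i \in A -> pos j <= pos i) -> minpos A = pos j.
Proof.
move=> jA h; have [k kA E] := minpos_ex jA.
by have := h k kA; have := minpos_le jA; lia.
Qed.

Lemma adjacentP A B : reflect (exists j k, [/\ j \in A, k \in B,
    forall i, i \in A -> pos i <= pos j, forall i, i \in B -> pos k <= pos i
    & pos k = (pos j).+1]) (adj A B).
Proof.
apply: (iffP exists_inP) => [[j jA /exists_inP[k kB /and3P[hA hB /eqP E]]]|].
  by exists j, k; split=> // i iX; [apply: (forall_inP hA)|apply: (forall_inP hB)].
move=> [j [k [jA kB hA hB E]]]; exists j => //; apply/exists_inP; exists k => //.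
by apply/and3P; split; [apply/forall_inP|apply/forall_inP|apply/eqP].
Qed.

Lemma adjacent_minposE A B : adj A B -> minpos B = (maxpos A).+1.
Proof.
move=> /adjacentP[j [k [jA kB hA hB E]]].
by rewrite (maxpos_eq jA hA) (minpos_eq kB hB).
Qed.

Lemma adjacent_minpos A B i j : i \in A -> j \in B -> minpos B = (maxpos A).+1 -> adj A B.
Proof.
move=> iA jB E; have [i' iA' Ei] := maxpos_ex iA; have [j' jB' Ej] := minpos_ex jB.
apply/adjacentP; exists i', j'; split=> // [k|k|]; last by rewrite Ei Ej.
  by rewrite Ei; apply: maxpos_ge.
by rewrite Ej; apply: minpos_le.
Qed.

Lemma minpos_le_maxpos A i : i \in A -> minpos A <= maxpos A.
Proof. by move=> iA; apply: leq_trans (minpos_le iA) (maxpos_ge iA). Qed.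

Lemma disj_pos P A B i j : disj P -> A \in P -> B \in P -> i \in A -> j \in B ->
  pos i = pos j -> A = B.
Proof. by move=> d AP BP iA jB /cpos_inj ij; apply: (d A B i); rewrite // ij. Qed.

(** The position following [maxpos A] lies in at most one block, and so does the one preceding
    [minpos B]; the rank is [minpos]. *)
Lemma adjacent_path_like P : blocks P -> path_like adj minpos P.
Proof.
move=> [d ne]; split=> [A B B' AP BP BP'|B A A' BP AP AP'|A B AP BP].
- have [k kB] := ne _ BP; have [k' kB'] := ne _ BP'.
  have [l lB El] := minpos_ex kB; have [l' lB' El'] := minpos_ex kB'.
  move=> /adjacent_minposE E /adjacent_minposE E'; apply: (disj_pos d BP BP' lB lB'); lia.
- have [k kA] := ne _ AP; have [k' kA'] := ne _ AP'.
  have [l lA El] := maxpos_ex kA; have [l' lA' El'] := maxpos_ex kA'.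
  move=> /adjacent_minposE E /adjacent_minposE E'; apply: (disj_pos d AP AP' lA lA'); lia.
have [k kA] := ne _ AP; move=> /adjacent_minposE ->; have := minpos_le_maxpos kA; lia.
Qed.

Lemma path_bounds P A s : blocks P -> A \in P -> path (restr adj P) A s ->
  forall B, B \in A :: s -> minpos A <= minpos B /\ maxpos B <= maxpos (last A s).
Proof.
move=> bP; elim: s A => [|A' s IH] A AP /=.
  by move=> _ B; rewrite inE => /eqP->.
case/andP=> /and3P[_ AP' /adjacent_minposE E] /(IH _ AP') {}IH.
have [k kA] := bP.2 _ AP; have [k' kA'] := bP.2 _ AP'.
have km := minpos_le_maxpos kA; have km' := minpos_le_maxpos kA'.
have [_ h] := IH _ (mem_head _ _).
move=> B; rewrite inE => /orP[/eqP->|/IH[? ?]]; split=> //; lia.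
Qed.

Lemma cover_seqP (s : seq {set 'I_n}) i :
  reflect (exists2 B, B \in s & i \in B) (i \in cover [set B in s]).
Proof.
apply: (iffP bigcupP) => -[B Bs iB]; exists B => //; first by rewrite inE in Bs.
by rewrite inE.
Qed.

(** * The adjacent closure *)

Section Closure.
Variable P : {set {set 'I_n}}.
Hypothesis bP : blocks P.

Let linP := adjacent_path_like bP.

Definition chained K := exists A s,
  [/\ A \in P, path (restr adj P) A s & K = cover [set B in A :: s]].

(** The invariant of merging, valid whichever adjacent pair [pick] returns. The paths behind the
    merged blocks need not be maximal yet. *)
Definition coarsening Q := [/\ forall K, K \in Q -> chained K, disj Q
  & forall A, A \in P -> exists2 K, K \in Q & A \subset K].

Lemma chain_mem A s i : A \in P -> path (restr adj P) A s ->
  i \in cover [set B in A :: s] -> minpos A <= pos i <= maxpos (last A s).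
Proof.
move=> AP ps /cover_seqP[B Bs iB].
have [lo hi] := path_bounds bP AP ps Bs.
by have := minpos_le iB; have := maxpos_ge iB; lia.
Qed.

(** Together with [maxpos_chain], this reduces adjacency of merged blocks to adjacency of the last
    block of one path and the first block of the other. *)
Lemma minpos_chain A s : A \in P -> path (restr adj P) A s ->
  minpos (cover [set B in A :: s]) = minpos A.
Proof.
move=> AP ps; have [k kA] := bP.2 _ AP; have [l lA E] := minpos_ex kA.
rewrite -E; apply: minpos_eq; first by apply/cover_seqP; exists A; rewrite ?mem_head.
by move=> i /(chain_mem AP ps); lia.
Qed.

Lemma maxpos_chain A s : A \in P -> path (restr adj P) A s ->
  maxpos (cover [set B in A :: s]) = maxpos (last A s).
Proof.
move=> AP ps; have lP : last A s \in P by apply: (path_sub AP ps); apply: mem_last.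
have [k kA] := bP.2 _ lP; have [l lA E] := maxpos_ex kA.
rewrite -E; apply: maxpos_eq; first by apply/cover_seqP; exists (last A s); rewrite ?mem_last.
by move=> i /(chain_mem AP ps); lia.
Qed.

Lemma chained_ne K : chained K -> exists i, i \in K.
Proof.
case=> A [s [AP _ ->]]; have [i iA] := bP.2 _ AP; exists i.
by apply/cover_seqP; exists A; rewrite ?mem_head.
Qed.

Lemma sub_chain B A s : B \in P -> A \in P -> path (restr adj P) A s ->
  B \subset cover [set B in A :: s] -> B \in A :: s.
Proof.
move=> BP AP ps sub; have [i iB] := bP.2 _ BP.
have /cover_seqP[C Cs iC] := subsetP sub _ iB.
by rewrite (bP.1 B C i) //; apply: (path_sub AP ps).
Qed.

Lemma coarsening_refl : coarsening P.
Proof.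
split=> [A AP||A AP]; [|exact: bP.1|by exists A].
exists A, [::]; split=> //; apply/setP => i.
apply/idP/cover_seqP => [iA|[B]]; first by exists A; rewrite ?mem_head.
by rewrite inE => /eqP->.
Qed.

(** When two merged blocks are adjacent, their underlying paths concatenate; the two blocks are
    replaced by one, so the number of blocks drops. *)
Lemma merge_stepP Q : coarsening Q ->
  coarsening (merge_step z Q) /\
  ((merge_step z Q = Q /\ {in Q &, forall K K', ~~ adj K K'}) \/
   #|merge_step z Q| < #|Q|).
Proof.
move=> cQ; rewrite /merge_step; case: pickP => [[K K'] /= /and3P[KQ KQ' aK]|no]; last first.
  split=> //; left; split=> // K K' KQ KQ'; apply/negP => aK.
  by have := no (K, K'); rewrite /= KQ KQ' aK.
case: cQ => ch dQ cov; have [i iK] := chained_ne (ch _ KQ).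
have KK' : K != K'.
  by apply/eqP => E; have := adjacent_minposE aK; rewrite -E; have := minpos_le_maxpos iK; lia.
split; last first.
  right; rewrite cardsU1; have := leq_b1 (K :|: K' \notin Q :\ K :\ K').
  have := cardsD1 K Q; have := cardsD1 K' (Q :\ K).
  rewrite KQ 2!inE KQ' eq_sym KK' /=; lia.
split.
- move=> X; rewrite !inE => /orP[/eqP->|/and3P[_ _ /ch //]].
  case: (ch _ KQ) (ch _ KQ') => A [s [AP ps EK]] [A' [s' [AP' ps' EK']]].
  exists A, (s ++ A' :: s'); split=> //.
    rewrite cat_path ps /= ps' andbT; have [j jA'] := bP.2 _ AP'.
    have lP : last A s \in P by apply: (path_sub AP ps); apply: mem_last.
    have [k kl] := bP.2 _ lP.
    apply/and3P; split=> //; apply: (adjacent_minpos kl jA').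
    by rewrite -(minpos_chain AP' ps') -(maxpos_chain AP ps) -EK -EK'; apply: adjacent_minposE.
  apply/setP => x; rewrite inE EK EK'; apply/orP/cover_seqP.
    case=> /cover_seqP[B Bs xB]; exists B; rewrite // -cat_cons mem_cat Bs ?orbT //.
  case=> B; rewrite -cat_cons mem_cat => /orP[Bs|Bs] xB; [left|right];
    by apply/cover_seqP; exists B.
- move=> X Y x; rewrite !inE => /orP[/eqP->|/and3P[XK' XK XQ]] /orP[/eqP->|/and3P[YK' YK YQ]] //.
  + rewrite inE => /orP[xK|xK] xY; first by rewrite (dQ K Y x) ?eqxx in YK.
    by rewrite (dQ K' Y x) ?eqxx in YK'.
  + move=> xX; rewrite inE => /orP[xK|xK]; first by rewrite (dQ K X x) ?eqxx in XK.
    by rewrite (dQ K' X x) ?eqxx in XK'.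
  by apply: dQ.
move=> B /cov[X XQ BX]; case: (boolP ((X == K) || (X == K'))) => [XKK|].
  exists (K :|: K'); first by rewrite !inE eqxx.
  apply: subset_trans BX _; case/orP: XKK => /eqP->; [exact: subsetUl|exact: subsetUr].
rewrite negb_or => /andP[XK XK']; exists X => //.
by rewrite !inE XK XK' XQ orbT.
Qed.

Lemma adjacent_closureP : let Q := adjacent_closure z P in
  coarsening Q /\ {in Q &, forall K K', ~~ adj K K'}.
Proof.
rewrite /adjacent_closure.
(* After m steps either no adjacent pair is left or at least m blocks have disappeared. For m =
   [#|P|] the second case leaves no block at all, which is stable too. *)
have H m : let Q := iter m (merge_step z) P in coarsening Q /\
    ({in Q &, forall K K', ~~ adj K K'} \/ #|Q| + m <= #|P|).
  elim: m => [|m [cQ IH]] /=; first by split; [exact: coarsening_refl|right; rewrite addn0].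
  have [cQ' h] := merge_stepP cQ; split=> //.
  case: h => [[-> h]|lt]; first by left.
  case: IH => [st|le]; last first.
    by right; rewrite addnS -addSn (leq_trans _ le) // leq_add2r.
  have : merge_step z (iter m (merge_step z) P) = iter m (merge_step z) P.
    rewrite /merge_step; case: pickP => // -[K K'] /= /and3P[KQ KQ' aK].
    by rewrite (negbTE (st _ _ KQ KQ')) in aK.
  by move=> E; rewrite E ltnn in lt.
have [cQ [//|le]] := H #|P|; split=> //; set Q := iter _ _ _ in le *.
have /eqP : #|Q| = 0 by lia.
by rewrite cards_eq0 => /eqP -> K K'; rewrite inE.
Qed.

Lemma restr_last A s : A \in P -> path (restr adj P) A s -> last A s \in P.
Proof. by move=> AP ps; apply: (path_sub AP ps); apply: mem_last. Qed.

Lemma path_pred A s D : path (restr adj P) A s -> D \in A :: s -> D != A ->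
  exists2 B, B \in A :: s & restr adj P B D.
Proof.
move=> ps; rewrite in_cons => /orP[/eqP-> /eqP //|Ds _].
case/splitPr: Ds ps => s1 s2; rewrite cat_path => /andP[_ /andP[r _]].
by exists (last A s1) => //; rewrite -cat_cons mem_cat mem_last.
Qed.

Lemma path_succ A s D : path (restr adj P) A s -> D \in A :: s -> D != last A s ->
  exists2 B, B \in A :: s & restr adj P D B.
Proof.
elim: s A => [|A' s IH] A /=; first by rewrite inE => _ ->.
case/andP=> r ps; rewrite in_cons => /orP[/eqP-> _|Ds dl].
  by exists A' => //; rewrite !inE eqxx orbT.
by have [B Bs rB] := IH _ ps Ds dl; exists B => //; rewrite in_cons Bs orbT.
Qed.

Lemma restrA A B : restr adj P A B -> adj A B.
Proof. by case/and3P. Qed.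

(** Suppose a block [D] extends the path of [K] at its end. If [D] begins the path of its own merged
    block [K'], then [K] and [K'] are adjacent, against stability. Otherwise the predecessor of [D]
    in that path is the last block of [K], so [K = K'], yet [D] lies beyond [K]. The front end is
    symmetric. *)
Lemma stable_chain Q : coarsening Q -> {in Q &, forall K K', ~~ adj K K'} ->
  forall K A s, K \in Q -> A \in P -> path (restr adj P) A s ->
  K = cover [set B in A :: s] -> A \in heads adj P /\ chain adj P A s.
Proof.
move=> [ch dQ cov] st K A s KQ AP ps EK.
have lP := restr_last AP ps.
have [x xA] := bP.2 _ AP; have xK : x \in K.
  by rewrite EK; apply/cover_seqP; exists A; rewrite ?mem_head.
have [y yl] := bP.2 _ lP; have yK : y \in K.
  by rewrite EK; apply/cover_seqP; exists (last A s); rewrite ?mem_last.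
split; last first.
  split=> // D; apply/negP => rD; have DP : D \in P by case/and3P: rD.
  have [K' KQ' DK'] := cov _ DP; have [A' [s' [AP' ps' EK']]] := ch _ KQ'.
  have Ds' : D \in A' :: s' by apply: sub_chain; rewrite // -EK'.
  have aD := adjacent_minposE (restrA rD).
  have [w wK'] := chained_ne (ch _ KQ').
  case: (eqVneq D A') => [DA'|DA'].
    move: (st _ _ KQ KQ'); rewrite (adjacent_minpos yK wK') //.
    by rewrite EK' (minpos_chain AP' ps') EK (maxpos_chain AP ps) -DA'.
  have [B Bs' rB] := path_pred ps' Ds' DA'.
  have BE : B = last A s.
    case: linP => _ i _; case/and3P: rB => BP _ aB; apply: (i D) => //; exact: restrA.
  have E : K = K'.
    apply: (dQ _ _ y) => //; rewrite EK'; apply/cover_seqP; exists B => //.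
    by rewrite BE.
  have [v vD] := bP.2 _ DP; have vK : v \in K by rewrite E; apply: (subsetP DK').
  move: vK; rewrite EK => /(chain_mem AP ps)/andP[_ /(leq_trans (minpos_le vD))].
  by rewrite aD ltnn.
rewrite inE AP /=; apply/forall_inP => D DP; apply/negP => aD.
have [K' KQ' DK'] := cov _ DP; have [A' [s' [AP' ps' EK']]] := ch _ KQ'.
have Ds' : D \in A' :: s' by apply: sub_chain; rewrite // -EK'.
have [w wK'] := chained_ne (ch _ KQ').
case: (eqVneq D (last A' s')) => [DA'|DA'].
  move: (st _ _ KQ' KQ); rewrite (adjacent_minpos wK' xK) //.
  by rewrite EK (minpos_chain AP ps) EK' (maxpos_chain AP' ps') -DA' (adjacent_minposE aD).
have [B Bs' rB] := path_succ ps' Ds' DA'.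
have BE : B = A.
  case: linP => f _ _; case/and3P: rB => _ BP aB; apply: (f D) => //.
have E : K = K'.
  apply: (dQ _ _ x) => //; rewrite EK'; apply/cover_seqP; exists B => //.
  by rewrite BE.
have [v vD] := bP.2 _ DP; have vK : v \in K by rewrite E; apply: (subsetP DK').
move: vK; rewrite EK => /(chain_mem AP ps)/andP[/leq_trans/(_ (maxpos_ge vD)) + _].
by rewrite (adjacent_minposE aD) ltnn.
Qed.

Lemma adjacent_closureE :
  adjacent_closure z P = [set cover (reach adj P A) | A in heads adj P].
Proof.
have [] := adjacent_closureP; set Q := adjacent_closure z P => cQ st.
have [ch dQ cov] := cQ.
apply/setP => K; apply/idP/imsetP => [KQ|[A Ah ->]].
  have [A [s [AP ps EK]]] := ch _ KQ; have [Ah c] := stable_chain cQ st KQ AP ps EK.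
  by exists A => //; rewrite (reach_chain linP c).
have AP : A \in P by move: Ah; rewrite inE => /andP[].
have [K' KQ' AK'] := cov _ AP; have [A' [s' [AP' ps' EK']]] := ch _ KQ'.
have [Ah' c] := stable_chain cQ st KQ' AP' ps' EK'.
have As' : A \in A' :: s' by apply: sub_chain; rewrite // -EK'.
by rewrite (head_path Ah' As' ps' Ah) (reach_chain linP c) -EK'.
Qed.

(** The closed blocks are the unions of the maximal chains, and a block of [P] is contained in such
    a union exactly when it belongs to the chain. *)
Lemma Crel_closure : Crel (adjacent_closure z P) P = chain_weight adj P.
Proof.
have sub A B : A \in heads adj P -> B \in P ->
    (B \subset cover (reach adj P A)) = (B \in reach adj P A).
  move=> Ah BP; have AP : A \in P by move: Ah; rewrite inE => /andP[].
  have [s c] := chain_ex linP A; rewrite (reach_chain linP c).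
  rewrite in_set; apply/idP/idP => [/(sub_chain BP AP c.1) //|Bs].
  by apply/subsetP => i iB; apply/cover_seqP; exists B.
rewrite /Crel adjacent_closureE big_imset /=.
  apply: eq_bigr => A Ah; congr catalan; apply: eq_card => B; rewrite inE.
  case: (boolP (B \in P)) => [BP|BP]; first by rewrite sub.
  apply/esym/negbTE; apply: contra BP; have [s c] := chain_ex linP A.
  rewrite (reach_chain linP c) inE; apply: (path_sub _ c.1).
  by move: Ah; rewrite inE => /andP[].
move=> A A' Ah Ah' /= E; have AP : A \in P by move: Ah; rewrite inE => /andP[].
apply: (reach_heads_disj linP Ah Ah' (y := A)); first by rewrite inE connect0.
by rewrite -sub // -E sub // inE connect0.
Qed.

End Closure.
End Base.

(** * Independence of the base point *)

Lemma cpos_rebase z z' i :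
  cpos z' i = if cpos z z' <= cpos z i then cpos z i - cpos z z'
              else cpos z i + n - cpos z z'.
Proof.
have := ltn_ord z; have := ltn_ord z'; have := ltn_ord i; rewrite !cposE.
move: {i z z'} (val z) (val z') (val i) => z z' i.
by case: (leqP z z') => ?; case: (leqP z i) => ?; case: (leqP z' i) => ?; leq_cases.
Qed.

(* A nonzero block lies in one of the two arcs between z and z', on which the *)
(* orders read from z and from z' differ by a shift.                          *)
Lemma adjacent_rebase Z P z z' : nc z (Z |: P) -> disj (Z |: P) -> Z \notin P ->
  z \in Z -> z' \in Z -> {in P &, forall A B, adjacent z A B -> adjacent z' A B}.
Proof.
move=> ncP d ZP zZ zZ' A B AP BP /adjacentP[j [k [jA kB hA hB E]]].
have ZZ : Z \in Z |: P by rewrite !inE eqxx.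
have nZ X : X \in P -> X \in Z |: P /\ Z <> X.
  by move=> XP; rewrite !inE XP orbT; split=> // ZX; rewrite ZX XP in ZP.
have off X i : X \in P -> i \in X -> cpos z i <> cpos z z' /\ cpos z i <> cpos z z.
  by move=> /nZ[XP ZX] iX; split=> /cpos_inj E'; apply: ZX; apply: (d _ _ i) => //; rewrite E'.
have side X i i' : X \in P -> i \in X -> i' \in X ->
    cpos z i < cpos z z' -> cpos z z' < cpos z i' -> False.
  move=> XP iX iX' lt gt; have [_ z0] := off _ _ XP iX; have [XP' ZX] := nZ _ XP.
  apply: (ncP _ _ ZZ XP' ZX z i z' i') => //; split=> //.
  by rewrite cpos_self lt0n; apply/eqP; rewrite -(cpos_self z).
have same X i i' : X \in P -> i \in X -> i' \in X ->
    (cpos z z' <= cpos z i) = (cpos z z' <= cpos z i').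
  move=> XP iX iX'; have [o _] := off _ _ XP iX; have [o' _] := off _ _ XP iX'.
  apply/idP/idP => h; rewrite leqNgt; apply/negP => lt.
    by apply: (side X i' i) => //; rewrite ltn_neqAle h andbT eq_sym; apply/eqP.
  by apply: (side X i i') => //; rewrite ltn_neqAle h andbT eq_sym; apply/eqP.
have [oj _] := off _ _ AP jA; have [ok _] := off _ _ BP kB.
apply/adjacentP; exists j, k; split=> // [i iA|i iB|].
- by move: (hA i iA); rewrite !(cpos_rebase z z') (same _ _ _ AP iA jA); clear; leq_cases.
- by move: (hB i iB); rewrite !(cpos_rebase z z') (same _ _ _ BP iB kB); clear; leq_cases.
by move: oj ok (cpos_lt z z'); rewrite !(cpos_rebase z z') E; clear; leq_cases.
Qed.

End Positions.

(** * Moving a block of the first gap into the zero block *)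

Section Pointed.
Variables (n : nat) (z : 'I_n).
Implicit Types (i j : 'I_n) (A B H Z : {set 'I_n}) (P : {set {set 'I_n}}).
Local Notation pos := (cpos z).
Local Notation adj := (adjacent z).
Local Notation minpos := (minpos z).
Local Notation maxpos := (maxpos z).

Definition pointed Z P := [/\ Z \notin P, blocks (Z |: P),
  forall i, i \in Z \/ exists2 A, A \in P & i \in A & nc z (Z |: P)].

Lemma pointedP (p : {set 'I_n} * {set {set 'I_n}}) : p \in PNC n <-> pointed p.1 p.2.
Proof.
rewrite inE; split=> [/and3P[ZP pt /(noncrossingP z) ncP]|[ZP bl cov ncP]].
  split=> //; first exact: partition_blocks.
  move=> i; have [A] := partition_mem i pt.
  by rewrite !inE => /orP[/eqP->|AP] iA; [left|right; exists A].
apply/and3P; split=> //; last exact/(noncrossingP z).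
apply: blocks_partition => // i; case: (cov i) => [iZ|[A AP iA]].
  by exists p.1; rewrite ?setU11.
by exists A; rewrite // setU1r.
Qed.

Section Structure.
Variables (Z : {set 'I_n}) (P : {set {set 'I_n}}).
Hypotheses (pZP : pointed Z P) (zZ : z \in Z).

Lemma pointed_blocks : blocks P.
Proof. by case: pZP => _ bl _ _; apply: blocks_sub bl; apply: subsetUr. Qed.
Let bP := pointed_blocks.

Lemma pointed_notin A i : A \in P -> i \in A -> i \notin Z.
Proof.
case: pZP => ZP [d _] _ _ AP iA; apply/negP => iZ.
by move: ZP; rewrite (d Z A i) ?setU11 ?setU1r // AP.
Qed.

Lemma pointed_cover i : i \notin Z -> exists2 A, A \in P & i \in A.
Proof. by case: pZP => _ _ /(_ i)[->|]. Qed.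

(** Since [z] has position 0, the points [z], [a], [x], [c] would be a crossing of [Z] and [A]. *)
Lemma nc_pointed A a x c : A \in P -> a \in A -> c \in A -> x \in Z ->
  ~ (pos a < pos x < pos c).
Proof.
move=> AP aA cA xZ /andP[ax xc]; case: (pZP) => ZP _ _ ncP.
apply: (ncP Z A _ _ _ z a x c) => //; rewrite ?setU11 ?setU1r //.
  by move=> E; rewrite E AP in ZP.
split=> //; rewrite cpos_self lt0n; apply: contra (pointed_notin AP aA) => /eqP E.
by rewrite (_ : a = z) //; apply: (@cpos_inj _ z); rewrite E cpos_self.
Qed.

Lemma nc_nonzero A B : A \in P -> B \in P -> A <> B ->
  forall a b c d, a \in A -> b \in B -> c \in A -> d \in B ->
  ~ [/\ pos a < pos b, pos b < pos c & pos c < pos d].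
Proof. by case: pZP => _ _ _ ncP AP BP; apply: ncP; rewrite setU1r. Qed.

Lemma minpos_pointed A x : A \in P -> x \in Z -> ~ (minpos A < pos x < maxpos A).
Proof.
move=> AP xZ; have [i iA] := bP.2 _ AP; have [j jA <-] := minpos_ex z iA.
by have [k kA <-] := maxpos_ex z iA; apply: (nc_pointed AP jA kA xZ).
Qed.

Lemma minpos_nc A B : A \in P -> B \in P ->
  ~ [/\ minpos A < minpos B, minpos B < maxpos A & maxpos A < maxpos B].
Proof.
move=> AP BP [h1 h2 h3]; have [i iA] := bP.2 _ AP; have [i' iB] := bP.2 _ BP.
have [j jA Ej] := minpos_ex z iA; have [k kA Ek] := maxpos_ex z iA.
have [j' jB Ej'] := minpos_ex z iB; have [k' kB Ek'] := maxpos_ex z iB.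
apply: (@nc_nonzero A B _ _ _ j j' k k') => //; last by rewrite Ej Ej' Ek Ek'.
by move=> E; rewrite E ltnn in h1.
Qed.

Definition enclosed B := exists2 A, A \in P & minpos A < minpos B < maxpos A.

(** If [A] starts before [B], the point [x] below [c] makes [B] enclosed by [A]; if [B] starts
    first, its minimum with [a], [x], [c] is a crossing. *)
Lemma nc_outer A B a x c : A \in P -> B \in P -> ~ enclosed B -> A <> B ->
  a \in A -> c \in A -> x \in B -> ~ (pos a < pos x < pos c).
Proof.
move=> AP BP outB AB aA cA xB /andP[ax xc].
have Ba := minpos_le z xB; have Ac := maxpos_ge z cA; have Aa := minpos_le z aA.
have [j jB Ej] := minpos_ex z xB.
case: (ltngtP (minpos A) (minpos B)) => [AmB|BmA|E].
- by apply: outB; exists A; rewrite // AmB (leq_ltn_trans Ba) // (leq_trans xc).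
- apply: (@nc_nonzero B A BP AP (nesym AB) j a x c) => //; split=> //.
  by rewrite Ej (leq_trans BmA).
have [k kA Ek] := minpos_ex z aA.
by apply: AB; apply: (disj_pos (z := z) bP.1 AP BP kA jB); rewrite Ek Ej.
Qed.

(** A new crossing would put a point of [Z :|: B] between two points of another block, which
    [nc_pointed] excludes for [Z] and [nc_outer] for [B]. *)
Lemma pointed_merge B : B \in P -> ~ enclosed B -> pointed (Z :|: B) (P :\ B).
Proof.
move=> BP outB; case: (pZP) => ZP [d ne] cov ncP; have [x xB] := bP.2 _ BP.
have sub A : A \in P :\ B -> A \in P /\ A <> B by case/setD1P => /eqP.
have dsj A i : A \in P :\ B -> i \in A -> i \notin Z :|: B.
  case/sub => AP AB iA; rewrite inE negb_or (pointed_notin AP iA) /=.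
  by apply/negP => iB; apply: AB; apply: (bP.1 A B i).
have btw A a c y : A \in P :\ B -> a \in A -> c \in A -> y \in Z :|: B ->
    ~ (pos a < pos y < pos c).
  case/sub => AP AB aA cA; rewrite inE => /orP[yZ|yB]; first exact: (nc_pointed AP).
  exact: (nc_outer AP BP).
split.
- by apply/negP => /sub[/pointed_notin/(_ (subsetP (subsetUl Z B) _ zZ))]; rewrite zZ.
- split=> [A A' i|A]; last first.
    case/setU1P => [->|/sub[AP _]]; first by exists x; rewrite inE xB orbT.
    by apply: ne; rewrite setU1r.
  case/setU1P => [->|AP] /setU1P[->|AP'] //.
  + by move=> iZ iA; move: (dsj _ _ AP' iA); rewrite iZ.
  + by move=> iA iZ; move: (dsj _ _ AP iA); rewrite iZ.
  by case/sub: AP => AP _; case/sub: AP' => AP' _; apply: bP.1.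
- move=> i; case: (cov i) => [iZ|[A AP iA]]; first by left; rewrite inE iZ.
  case: (eqVneq A B) => [AB|AB]; first by left; rewrite inE -AB iA orbT.
  by right; exists A; rewrite // !inE AB.
move=> A A' /setU1P[->|AP] /setU1P[->|AP'] // AA' a b c e aA bA cA eA [ab bc ce].
- by apply: (btw A' b e c) => //; rewrite bc.
- by apply: (btw A a c b) => //; rewrite ab.
case/sub: AP => AP _; case/sub: AP' => AP' _.
exact: (nc_nonzero AP AP' AA' aA bA cA eA).
Qed.

(** The converse of [pointed_merge]. Crossings with old blocks would be crossings with [Z], and the
    two parts of [Z] do not cross because [B] is an interval of [Z]. *)
Lemma pointed_split (lo hi : nat) B : B = [set x in Z | lo <= pos x < hi] ->
  z \notin B -> B != set0 -> pointed (Z :\: B) (B |: P).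
Proof.
move=> EB zB /set0Pn[x xB]; case: (pZP) => ZP [d ne] cov ncP.
have BZ i : i \in B -> i \in Z by rewrite EB inE => /andP[].
have mid i j k : i \in B -> j \in B -> k \in Z -> pos i < pos k < pos j -> k \in B.
  rewrite EB !inE => /and3P[_ l1 h1] /and3P[_ l2 h2] -> /andP[ik kj] /=.
  by rewrite (leq_trans l1 (ltnW ik)) (ltn_trans kj h2).
have zZB : z \in Z :\: B by rewrite inE zB zZ.
have BP : B \notin P by apply/negP => /pointed_notin/(_ xB); rewrite BZ.
split.
- rewrite !inE negb_or; apply/andP; split.
    by apply/eqP => E; move: zZB; rewrite E (negbTE zB).
  by apply/negP => /pointed_notin/(_ zZB); rewrite zZ.
- split=> [A A' i|A]; last first.
    case/setU1P => [->|/setU1P[->|AP]]; first by exists z.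
      by exists x.
    by apply: ne; rewrite setU1r.
  case/setU1P => [->|/setU1P[->|AP]] /setU1P[->|/setU1P[->|AP']] //.
  + by rewrite inE => /andP[/negbTE->].
  + by rewrite inE => /andP[_ iZ] /(pointed_notin AP'); rewrite iZ.
  + by move=> iB; rewrite inE iB.
  + by move=> /BZ iZ /(pointed_notin AP'); rewrite iZ.
  + by move=> /(pointed_notin AP) iZ; rewrite inE (negbTE iZ) andbF.
  + by move=> /(pointed_notin AP) iZ /BZ iB; rewrite iB in iZ.
  exact: bP.1.
- move=> i; case: (cov i) => [iZ|[A AP iA]].
    case: (boolP (i \in B)) => iB; first by right; exists B; rewrite ?setU11.
    by left; rewrite inE iB iZ.
  by right; exists A; rewrite // setU1r.
have big A : A \in (Z :\: B) |: (B |: P) -> A \in P \/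
    (A \notin P /\ A \subset Z /\ (A = Z :\: B \/ A = B)).
  case/setU1P => [->|/setU1P[->|AP]]; last by left.
    right; split; first by apply/negP => /pointed_notin/(_ zZB); rewrite zZ.
    by split; [apply: subsetDl|left].
  right; split => //; split; last by right.
  by apply/subsetP => i; apply: BZ.
have ZX A : A \in P -> Z <> A by move=> AP E; rewrite E AP in ZP.
move=> A A' /big hA /big hA' AA' a b c e aA bA cA eA h.
case: hA hA' => [AP|[_ [sA kA]]] [AP'|[_ [sA' kA']]].
- exact: (nc_nonzero AP AP' AA' aA bA cA eA).
- by apply: (ncP A Z _ _ (nesym (ZX _ AP)) a b c e); rewrite ?setU11 ?setU1r //;
     apply: (subsetP sA').
- by apply: (ncP Z A' _ _ (ZX _ AP') a b c e); rewrite ?setU11 ?setU1r //;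
     apply: (subsetP sA).
case: h => ab bc ce; case: kA AA' aA cA => ->; case: kA' bA eA => -> // bA eA _ aA cA.
  move: cA; rewrite inE => /andP[/negP cB cZ]; apply: cB.
  by apply: (mid b e) => //; rewrite bc.
move: bA; rewrite inE => /andP[/negP bB bZ]; apply: bB.
by apply: (mid a c) => //; rewrite ab.
Qed.

Section FirstGap.
Variables (q : nat) (y : 'I_n) (H : {set 'I_n}).
Hypothesis initZ : forall j, pos j < q -> j \in Z.
Hypotheses (HP : H \in P) (yH : y \in H) (yq : pos y = q).

Lemma nonzero_ge A i : A \in P -> i \in A -> q <= pos i.
Proof. by move=> AP iA; rewrite leqNgt; apply: contra (pointed_notin AP iA); apply: initZ. Qed.

Lemma minpos_ge A : A \in P -> q <= minpos A.
Proof.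
move=> AP; have [i iA] := bP.2 _ AP; have [j jA <-] := minpos_ex z iA.
exact: nonzero_ge jA.
Qed.

Lemma minpos_gap : minpos H = q.
Proof. by apply/eqP; rewrite eqn_leq minpos_ge // andbT -yq minpos_le. Qed.

Lemma gap_head : H \in heads adj P.
Proof.
rewrite inE HP /=; apply/forall_inP => A AP; apply/negP => /adjacent_minposE.
rewrite minpos_gap => E; have [i iA] := bP.2 _ AP; have := minpos_le_maxpos z iA.
by have := minpos_ge AP; rewrite E ltnNge => /negP h1 h2; apply: h1.
Qed.

(** The maximal blocks of the gap of [Z] that starts at position [q]; by [reach_outer] and
    [outer_reach] they form the adjacency chain of [H]. *)
Definition outer B := [/\ B \in P, forall x, x \in Z -> q <= pos x -> maxpos B < pos x
  & ~ enclosed B].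

Lemma outer_beyond B : B \in P -> (forall x, x \in Z -> q <= pos x -> minpos B < pos x) ->
  forall x, x \in Z -> q <= pos x -> maxpos B < pos x.
Proof.
move=> BP h x xZ qx; case: (ltngtP (maxpos B) (pos x)) => // [xm|E].
  by case: (minpos_pointed BP xZ); rewrite h.
have [i iB] := bP.2 _ BP; have [j jB Ej] := maxpos_ex z iB.
have : j \notin Z := pointed_notin BP jB.
by rewrite (_ : j = x) ?xZ //; apply: (@cpos_inj _ z); rewrite Ej.
Qed.

(** Induction along the chain. A block enclosing the next chain element [B] would enclose the
    preceding one, cross it, or share a point with it. *)
Lemma reach_outer B : B \in reach adj P H -> outer B.
Proof.
rewrite inE => /connectP[s]; elim/last_ind: s B => [|s D IH] B /=.
  move=> _ ->; split=> //.
    apply: outer_beyond => // x xZ; rewrite minpos_gap leq_eqVlt => /orP[/eqP E|//].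
    have := pointed_notin HP yH; rewrite (_ : y = x) ?xZ //.
    by apply: (@cpos_inj _ z); rewrite yq.
  by case=> A AP /andP[]; rewrite minpos_gap ltnNge minpos_ge.
rewrite rcons_path last_rcons => /andP[ps r] ->.
have [BP beyB outB] := IH _ ps erefl; have /and3P[_ DP /adjacent_minposE E] := r.
set B' := last H s in BP beyB outB r E; have [i iB] := bP.2 _ BP.
split=> //.
  apply: outer_beyond => // x xZ qx; rewrite E ltn_neqAle beyB // andbT.
  apply/eqP => Ex; have [k kD] := bP.2 _ DP; have [l lD El] := minpos_ex z kD.
  have := pointed_notin DP lD; rewrite (_ : l = x) ?xZ //.
  by apply: (@cpos_inj _ z); rewrite El E.
case=> A AP /andP[h1 h2].
have AB : A <> B'.
  by move=> AB; move: h2; rewrite AB E ltnNge leqnSn.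
have h3 : maxpos B' < maxpos A by apply: leq_trans h2; rewrite E.
have [k kA] := bP.2 _ AP.
case: (ltngtP (minpos A) (minpos B')) => [lt|gt|eq].
- by apply: outB; exists A; rewrite // lt (leq_ltn_trans (minpos_le_maxpos z iB)).
- apply: (@minpos_nc B' A) => //; split=> //.
  move: h1; rewrite E ltnS leq_eqVlt => /orP[/eqP eq|//].
  have [l lA El] := minpos_ex z kA; have [m mB Em] := maxpos_ex z iB.
  by case: AB; apply: (disj_pos (z := z) bP.1 AP BP lA mB); rewrite El Em.
have [l lA El] := minpos_ex z kA; have [m mB Em] := minpos_ex z iB.
by case: AB; apply: (disj_pos (z := z) bP.1 AP BP lA mB); rewrite El Em.
Qed.

(** Induction on the position of [B]. The point just before [B] is in the gap, hence in a nonzero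
    block; that block ends there, else it would enclose [B]. So it is adjacent to [B], and it is
    outer as well. *)
Lemma outer_reach B : outer B -> B \in reach adj P H.
Proof.
have [m] := ubnP (minpos B); elim: m B => // m IH B Bm [BP beyB outB].
have [i iB] := bP.2 _ BP; have [j jB Ej] := minpos_ex z iB.
have := minpos_ge BP; rewrite leq_eqVlt => /orP[/eqP E|qB].
  rewrite (_ : B = H) ?inE ?connect0 //.
  by apply: (disj_pos (z := z) bP.1 BP HP jB yH); rewrite Ej yq.
have mB0 : minpos B = (minpos B).-1.+1 by rewrite prednK // (leq_trans _ qB).
have [p Ep] : exists p, pos p = (minpos B).-1.
  by apply: cpos_surj; rewrite -mB0 -Ej ltnW // cpos_lt.
have qp : q <= pos p by rewrite Ep -ltnS -mB0.
have pB : pos p < minpos B by rewrite Ep [in X in _ < X]mB0.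
have pZ : p \notin Z.
  apply/negP => pZ; have := beyB _ pZ qp; rewrite ltnNge => /negP; apply.
  by rewrite ltnW // (leq_trans pB) // (minpos_le_maxpos z iB).
have [A AP pA] := pointed_cover pZ.
have Ap : minpos A <= pos p := minpos_le z pA.
have AB : A <> B by move=> AB; move: pB; rewrite -AB ltnNge Ap.
have mxA : maxpos A = pos p.
  apply/eqP; rewrite eqn_leq maxpos_ge // andbT leqNgt; apply/negP => lt.
  have [k kA Ek] := maxpos_ex z pA.
  apply: outB; exists A => //; rewrite (leq_ltn_trans Ap pB) /= ltn_neqAle.
  rewrite [in X in _ && X]mB0 -Ep lt andbT; apply/eqP => E.
  by apply: AB; apply: (disj_pos (z := z) bP.1 AP BP kA jB); rewrite Ek Ej.
have adjAB : adj A B by apply: (adjacent_minpos pA iB); rewrite mxA Ep -mB0.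
have AmB : minpos A < minpos B := leq_ltn_trans Ap pB.
have : A \in reach adj P H.
  apply: IH; first by apply: leq_trans AmB _; rewrite -ltnS.
  split=> // [x xZ qx|[A' AP' /andP[h1 h2]]].
    rewrite mxA (ltn_trans pB) // (leq_ltn_trans (minpos_le_maxpos z iB)) //; exact: beyB.
  have A'B : A' <> B by move=> E; move: h1; rewrite E ltnNge ltnW.
  have [k kA'] := bP.2 _ AP'; have [l lA' El] := maxpos_ex z kA'.
  apply: outB; exists A' => //; rewrite (ltn_trans h1 AmB) /=.
  have A'A : A' <> A by move=> E; rewrite E ltnn in h1.
  case: (ltngtP (maxpos A') (maxpos A)) => [lt|gt|eq]; last 1 first.
  - have [l' lA El'] := maxpos_ex z pA.
    by case: A'A; apply: (disj_pos (z := z) bP.1 AP' AP lA' lA); rewrite El El'.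
  - by case: (@minpos_nc A' A).
  rewrite ltn_neqAle [in X in _ && X]mB0 -Ep -mxA gt andbT; apply/eqP => E.
  by apply: A'B; apply: (disj_pos (z := z) bP.1 AP' BP lA' jB); rewrite El Ej.
rewrite !inE => /connect_trans; apply; apply: connect1.
by apply/and3P.
Qed.

End FirstGap.
End Structure.
End Pointed.

(** * Bijectivity of the gap move *)

Section GapBijection.
Variables (n : nat) (z : 'I_n).
Implicit Types (i j : 'I_n) (A B H Z : {set 'I_n}) (P : {set {set 'I_n}}).
Implicit Types p : {set 'I_n} * {set {set 'I_n}}.
Local Notation pos := (cpos z).
Local Notation adj := (adjacent z).

Definition initial q : {set 'I_n} := [set j | pos j < q].

Definition PNCinit q k : {set {set 'I_n} * {set {set 'I_n}}} :=
  [set p in PNC n | (initial q \subset p.1) && (#|p.1| == k)].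

Lemma in_PNCinit q k p : p \in PNCinit q k =
  [&& p \in PNC n, initial q \subset p.1 & #|p.1| == k].
Proof. by rewrite in_set. Qed.

Definition block_of P i : {set 'I_n} := odflt set0 [pick A in P | i \in A].

Definition gap_move (x : ({set 'I_n} * {set {set 'I_n}}) * {set 'I_n}) :=
  (x.1.1 :|: x.2, x.1.2 :\ x.2).

Definition gap_domain q k b (y : 'I_n) :=
  [set x : ({set 'I_n} * {set {set 'I_n}}) * {set 'I_n} |
    [&& x.1 \in PNCinit q k, y \notin x.1.1, x.2 \in reach adj x.1.2 (block_of x.1.2 y)
      & #|x.2| == b]].

Lemma in_gap_domain q k b y x : x \in gap_domain q k b y =
  [&& x.1 \in PNCinit q k, y \notin x.1.1, x.2 \in reach adj x.1.2 (block_of x.1.2 y)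
      & #|x.2| == b].
Proof. by rewrite in_set. Qed.

Lemma initialS q y : pos y = q -> initial q.+1 = y |: initial q.
Proof.
move=> yq; apply/setP => j; rewrite !inE ltnS leq_eqVlt; congr (_ || _).
by apply/eqP/eqP => [E|->//]; apply: (@cpos_inj _ z); rewrite E.
Qed.

Lemma card_initial q : q <= n -> #|initial q| = q.
Proof.
elim: q => [|q IH] qn.
  by apply/eqP; rewrite cards_eq0; apply/eqP/setP => j; rewrite !inE.
have [y yq] := cpos_surj z qn.
by rewrite (initialS yq) cardsU1 inE yq ltnn /= IH // ltnW.
Qed.

Lemma block_ofP Z P y : pointed z Z P -> y \notin Z ->
  block_of P y \in P /\ y \in block_of P y.
Proof.
move=> pZP yZ; rewrite /block_of; case: pickP => [A /andP[//]|no].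
by have [A AP yA] := pointed_cover pZP yZ; have := no A; rewrite AP yA.
Qed.

Lemma mem_PNCinit q k p : 0 < q -> p \in PNCinit q k ->
  [/\ pointed z p.1 p.2, z \in p.1, forall j, pos j < q -> j \in p.1 & #|p.1| = k].
Proof.
move=> q0; rewrite inE => /and3P[/(pointedP z) pp /subsetP ini /eqP pk].
have ini' j : pos j < q -> j \in p.1 by move=> jq; apply: ini; rewrite inE.
by split=> //; apply: ini'; rewrite cpos_self.
Qed.

(** A discrete intermediate value argument: the count grows by at most one when [t] does. *)
Lemma ex_threshold Z m : m <= #|Z| -> exists t, #|[set x in Z | pos x < t]| = m.
Proof.
move=> mZ; have H t : m <= #|[set x in Z | pos x < t]| ->
    exists t, #|[set x in Z | pos x < t]| = m.
  elim: t => [|t IH] le.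
    exists 0; apply/eqP; rewrite eqn_leq le andbT.
    by rewrite (_ : [set x in Z | _] = set0) ?cards0 //; apply/setP => x; rewrite !inE andbF.
  move: le; rewrite leq_eqVlt => /orP[/eqP E|lt]; first by exists t.+1.
  apply: IH; rewrite -ltnS (leq_trans lt) //.
  have [tn|nt] := ltnP t n; last first.
    rewrite leqW // subset_leq_card //; apply/subsetP => x; rewrite !inE => /andP[-> _] /=.
    exact: leq_trans (cpos_lt z x) nt.
  have [y yt] := cpos_surj z tn.
  rewrite (leq_trans (n := #|y |: [set x in Z | pos x < t]|)) //; last first.
    by rewrite cardsU1; case: (_ \notin _).
  apply: subset_leq_card; apply/subsetP => x; rewrite !inE ltnS leq_eqVlt.
  case/andP=> -> /orP[/eqP E|->]; last by rewrite orbT.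
  by apply/orP; left; apply/eqP; apply: (@cpos_inj _ z); rewrite E.
apply: (H n); rewrite (leq_trans mZ) // subset_leq_card //.
by apply/subsetP => x xZ; rewrite inE xZ cpos_lt.
Qed.

Section Fixed.
Variables (q : nat) (y : 'I_n).
Hypotheses (q0 : 0 < q) (yq : pos y = q).

Lemma mem_gap_domain k b p B : (p, B) \in gap_domain q k b y ->
  [/\ p \in PNCinit q k, y \notin p.1, outer z p.1 p.2 q B & #|B| = b].
Proof.
rewrite inE => /and4P[/= pX yp Br /eqP Bb]; split=> //.
have [pp zp ini _] := mem_PNCinit q0 pX; have [HP yH] := block_ofP pp yp.
exact: (reach_outer pp zp ini HP yH yq Br).
Qed.

Lemma outer_between Z P B : pointed z Z P -> (forall j, pos j < q -> j \in Z) ->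
  outer z Z P q B ->
  forall x, (x \in B) = (x \in Z :|: B) && (q <= pos x <= maxpos z B).
Proof.
move=> pp ini [BP beyB _] x; rewrite inE.
apply/idP/idP => [xB|/andP[/orP[xZ|//] /andP[qx xB]]].
  by rewrite xB orbT (nonzero_ge pp ini BP xB) maxpos_ge.
by have := beyB x xZ qx; rewrite ltnNge xB.
Qed.

(** By [outer_between], the moved block is an initial part of the points of the new zero block from
    position [q] on; its size [b] then determines it. *)
Lemma gap_move_inj k b : {in gap_domain q k b y &, injective gap_move}.
Proof.
move=> [p B] [p' B'] /mem_gap_domain[pX _ oB Bb] /mem_gap_domain[pX' _ oB' Bb'].
have [pp zp ini _] := mem_PNCinit q0 pX; have [pp' zp' ini' _] := mem_PNCinit q0 pX'.
rewrite /gap_move /= => -[EZ EP].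
have BE := outer_between pp ini oB; have BE' := outer_between pp' ini' oB'.
have EB : B = B'.
  case/orP: (leq_total (maxpos z B) (maxpos z B')) => le; last apply: esym; apply/eqP;
      rewrite eqEcard Bb Bb' leqnn andbT; apply/subsetP => x;
      rewrite BE BE' EZ => /andP[-> /andP[-> xm]];
      exact: leq_trans xm le.
have [BP _ _] := oB; have [BP' _ _] := oB'.
have dZ (r : {set 'I_n} * {set {set 'I_n}}) : pointed z r.1 r.2 -> B \in r.2 ->
    r.1 = (r.1 :|: B) :\: B.
  move=> pr Br; apply/setP => x; rewrite !inE; case: (boolP (x \in B)) => xB //=.
    by apply/negbTE; apply: (pointed_notin pr Br).
  by rewrite orbF.
rewrite -EB in EZ EP BP' *; rewrite [p]surjective_pairing [p']surjective_pairing.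
congr (_, _, _); first by rewrite (dZ p) // (dZ p') // EZ.
by rewrite -(setD1K BP) -(setD1K BP') EP.
Qed.

Lemma gap_move_onto k b : 0 < b -> q <= k ->
  gap_move @: gap_domain q k b y = PNCinit q (k + b).
Proof.
move=> b0 qk; apply/setP => p'; apply/imsetP/idP => [[[p B]]|].
  move=> /mem_gap_domain[pX _ [BP _ outB] Bb] ->.
  have [pp zp ini pk] := mem_PNCinit q0 pX.
  rewrite inE; apply/and3P; split.
  - exact/(pointedP z)/(pointed_merge pp zp BP outB).
  - by apply/subsetP => j; rewrite !inE => /ini ->.
  rewrite cardsU pk Bb (_ : _ :&: _ = set0) ?cards0 ?subn0 //.
  apply/setP => x; rewrite !inE; case: (boolP (x \in B)) => xB; rewrite ?andbF //.
  by rewrite (negbTE (pointed_notin pp BP xB)).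
move=> pX; have [pp zp ini pk] := mem_PNCinit q0 pX.
(* The threshold [t] cuts off [q + b] points of the zero block: the initial [q] ones and the [b]
   next ones, which are extracted as [B]. *)
have [|t Et] := @ex_threshold p'.1 (q + b); first by rewrite pk leq_add2r.
pose B := [set x in p'.1 | q <= pos x < t].
have qn : q < n by rewrite -yq cpos_lt.
have ci : #|initial q| = q by apply: card_initial; apply: ltnW.
have qt : q <= t.
  rewrite leqNgt; apply/negP => tq.
  suff : q + b <= q by rewrite -{2}(addn0 q) leq_add2l leqNgt b0.
  rewrite -{2}ci -Et; apply: subset_leq_card; apply/subsetP => x; rewrite !inE.
  by case/andP=> _ /ltn_trans; apply.
have Bb : #|B| = b.
  apply/eqP; rewrite -(eqn_add2l q) -Et -{1}ci; apply/eqP.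
  have -> : [set x in p'.1 | pos x < t] = initial q :|: B.
    apply/setP => x; rewrite !inE; case: (ltnP (pos x) q) => xq /=.
      by rewrite ini // (leq_trans xq qt).
    by [].
  rewrite cardsU (_ : _ :&: _ = set0) ?cards0 ?subn0 //.
  by apply/setP => x; rewrite !inE; case: ltnP; rewrite ?andbF.
have zB : z \notin B by rewrite inE cpos_self leqNgt q0 andbF.
have B0 : B != set0 by rewrite -card_gt0 Bb.
have BZ : B \subset p'.1 by apply/subsetP => x; rewrite inE => /andP[].
have ps := pointed_split pp zp (erefl B) zB B0.
have /set0Pn[x0 x0B] := B0.
have qt' : q < t by move: x0B; rewrite inE => /and3P[_ + +]; apply: leq_ltn_trans.
(* If [y] was in the zero block, it is now in [B]; otherwise nothing changed for it. *)
have yZ : y \notin p'.1 :\: B.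
  by rewrite !inE yq leqnn qt' /= andbT; case: (y \in _).
have ini2 j : pos j < q -> j \in p'.1 :\: B.
  by move=> jq; rewrite !inE ini // leqNgt jq.
have [HP yH] := block_ofP ps yZ.
have BP : B \notin p'.2.
  by apply/negP => /(pointed_notin pp)/(_ x0B); rewrite (subsetP BZ).
exists ((p'.1 :\: B, B |: p'.2), B).
  rewrite inE /=; apply/and4P; split=> //; last by rewrite Bb.
    rewrite inE; apply/and3P; split; first exact/(pointedP z).
      by apply/subsetP => j; rewrite inE; apply: ini2.
    by rewrite /= cardsD (setIidPr BZ) pk Bb addnK.
  apply: (outer_reach ps ini2 HP yH yq).
  split; first by rewrite setU11.
    move=> x; rewrite !inE => /andP[xB xZ] qx.
    move: xB; rewrite xZ qx /= -leqNgt; apply: leq_trans.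
    by have [l + <-] := maxpos_ex z x0B; rewrite inE => /and3P[].
  case=> A /setU1P[->|AP]; first by rewrite ltnn.
  have [l lB El] := minpos_ex z x0B; rewrite -El.
  by apply: (minpos_pointed pp zp AP); apply: (subsetP BZ).
rewrite /gap_move /= setU1K // [p']surjective_pairing /=; congr (_, _).
apply/setP => x; rewrite in_setU in_setD; case: (boolP (x \in B)) => xB /=;
  by rewrite ?orbF ?(subsetP BZ _ xB).
Qed.

End Fixed.
End GapBijection.

(** * Weighted sums *)

Section Weights.
Local Open Scope ring_scope.
Variables (R : comNzRingType) (a : nat -> R) (n : nat).
Implicit Types (z y : 'I_n) (p : {set 'I_n} * {set {set 'I_n}}).

Definition wt z p : R :=
  (-1) ^+ #|p.2| * (chain_weight (adjacent z) p.2)%:R * \prod_(B in p.2) a #|B|.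

Definition wt_sum z q k : R := \sum_(p in PNCinit z q k) wt z p.

(** The chain starting at the block of [y] is the one to which [chain_weight_split] is applied; a
    block moved to the zero block takes away one sign and its factor [a]. *)
Lemma wt_split z q k y p : (0 < q)%N -> cpos z y = q -> p \in PNCinit z q k ->
  y \notin p.1 ->
  wt z p = \sum_(B in reach (adjacent z) p.2 (block_of p.2 y))
             - (a #|B| * wt z (gap_move (p, B))).
Proof.
move=> q0 yq pX yp; have [pp zp ini pk] := mem_PNCinit q0 pX.
have [HP yH] := block_ofP pp yp.
have Hh := gap_head pp ini HP yH yq.
have lP := adjacent_path_like z (pointed_blocks pp).
rewrite /wt -(chain_weight_split lP Hh) natr_sum mulr_sumr mulr_suml.
apply: eq_bigr => B Br; have [BP _ _] := reach_outer pp zp ini HP yH yq Br.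
rewrite /gap_move /= (cardsD1 B p.2) BP (big_setD1 B BP) /=.
by rewrite exprD expr1 mulN1r !mulNr mulrCA.
Qed.

(** Partitions with the point at position [q] in the zero block give the first term. The others are
    expanded by [wt_split] and regrouped by the size of the moved block, where the gap move is a
    bijection. *)
Lemma wt_sum_rec z q k : (0 < q < n)%N -> (q <= k)%N ->
  wt_sum z q k = wt_sum z q.+1 k - \sum_(b < n | (0 < b)%N) a b * wt_sum z q (k + b).
Proof.
move=> /andP[q0 qn] qk; have [y yq] := cpos_surj z qn.
rewrite /wt_sum (bigID (fun p => y \in p.1)) /=; congr (_ + _).
  apply: eq_bigl => p; rewrite !in_PNCinit (initialS yq) subUset sub1set.
  by case: (p \in PNC n) => //=; case: (y \in _); rewrite ?andbT ?andbF.
under eq_bigr => p /andP[pX yp] do rewrite (wt_split q0 yq pX yp).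
rewrite pair_big_dep /=.
(* The size as an element of ['I_n], for use as a summation index. The default of [insubd] is never
   taken: a nonzero block misses [z], so it has fewer than n points. *)
pose szB (x : ({set 'I_n} * {set {set 'I_n}}) * {set 'I_n}) : 'I_n :=
  insubd (Ordinal (ltn_trans q0 qn)) #|x.2|.
have szE x : (x.1 \in PNCinit z q k) && (y \notin x.1.1) &&
    (x.2 \in reach (adjacent z) x.1.2 (block_of x.1.2 y)) ->
    (0 < #|x.2|)%N /\ (szB x = #|x.2| :> nat).
  move=> /andP[/andP[pX yp] Br].
  have [pp zp ini pk] := mem_PNCinit q0 pX; have [HP yH] := block_ofP pp yp.
  have [BP _ _] := reach_outer pp zp ini HP yH yq Br.
  have [i iB] := (pointed_blocks pp).2 _ BP.
  split; first by rewrite (cardD1 i) iB.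
  rewrite val_insubd; case: ltnP => // nB.
  have : z \in x.2.
    have /eqP -> : x.2 == setT by rewrite eqEcard subsetT cardsT card_ord.
    by rewrite inE.
  by move=> /(pointed_notin pp BP); rewrite zp.
rewrite (partition_big szB (fun b : 'I_n => (0 < b)%N)) /=; last first.
  by move=> x /szE[? ->].
rewrite -sumrN; apply: eq_bigr => b b0.
rewrite -(gap_move_onto q0 yq b0 qk) big_imset /=; last exact: (gap_move_inj q0 yq).
rewrite mulr_sumr -sumrN; apply: eq_big => [x|[p B] /andP[/szE[_ E] /eqP <-]].
  rewrite in_gap_domain -!andbA; have := szE x; case: (x.1 \in PNCinit z q k) => //=.
  case: (y \notin x.1.1) => //=.
  by case: (x.2 \in reach _ _ _) => //= /(_ isT)[_ E]; rewrite -val_eqE /= E.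
by rewrite E.
Qed.

Lemma wt_sum_gt z q k : (n < k)%N -> wt_sum z q k = 0.
Proof.
move=> nk; apply: big1 => p; rewrite inE => /and3P[_ _ /eqP E].
by have := max_card (mem p.1); rewrite card_ord E leqNgt nk.
Qed.

Lemma wt_sum_lt z q k : (k < q <= n)%N -> wt_sum z q k = 0.
Proof.
move=> /andP[kq qn]; apply: big1 => p; rewrite inE => /and3P[_ /subset_leq_card + /eqP E].
by rewrite (card_initial z qn) E leqNgt kq.
Qed.

Lemma wt_sum_full z : wt_sum z n n = 1.
Proof.
have iT : initial z n = [set: 'I_n] by apply/setP => j; rewrite !inE cpos_lt.
rewrite /wt_sum (big_pred1 ([set: 'I_n], set0)) => [|p].
  rewrite /wt /= cards0 big_set0 /chain_weight big1 ?expr0 ?mulr1 // => A.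
  by rewrite !inE.
apply/idP/eqP => [|->].
  move=> pX; have [pp zp ini _] := mem_PNCinit (leq_ltn_trans (leq0n z) (ltn_ord z)) pX.
  have pT : p.1 = setT by apply/setP => j; rewrite !inE ini // cpos_lt.
  rewrite [p]surjective_pairing pT; congr (_, _); apply/setP => A; rewrite inE.
  apply/negP => AP; have [i iA] := (pointed_blocks pp).2 _ AP.
  by have := pointed_notin pp AP iA; rewrite pT inE.
rewrite in_PNCinit /= subsetT cardsT card_ord eqxx !andbT; apply/(pointedP z).
split=> /=; first by rewrite inE.
- split=> [A B i|A]; first by rewrite setU0 !inE => /eqP-> /eqP->.
  by rewrite setU0 inE => /eqP->; exists z; rewrite inE.
- by move=> i; left; rewrite inE.
by move=> A B; rewrite setU0 !inE => /eqP-> /eqP->.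
Qed.

(** [cf N j] stands for [x^N] w^j. The recurrence calls [q + 1] with the same k, or the same q with
    a larger k; hence an outer induction on n - q and an inner one downwards in k. *)
Lemma wt_sum_coef z (cf : nat -> nat -> R) :
  (forall N j, (N < n)%N -> cf N.+1 j.+1 + \sum_(b < n | (0 < b)%N) a b * cf N.+1 (j.+1 + b)%N
     = cf N j) ->
  (forall N j, (N < j)%N -> cf N j = 0) -> cf 1 1 = 1 ->
  (forall N, cf N.+1 0 = 0) ->
  forall q k, (0 < q <= n)%N -> (q <= k)%N ->
  wt_sum z q k = cf (n - q).+1 (k - q).+1.
Proof.
move=> cf_rec cf_gt cf11 cf0 q k; move Em: (n - q)%N => m.
elim: m q k Em => [|m IHm] q k Em /andP[q0 qn] qk.
  have {Em} E : q = n by apply/eqP; rewrite eqn_leq qn -subn_eq0 Em eqxx.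
  rewrite E in q0 qk *; move: qk; rewrite leq_eqVlt => /orP[/eqP<-|nk].
    by rewrite wt_sum_full subnn cf11.
  by rewrite wt_sum_gt // cf_gt // ltnS subn_gt0.
have [j] := ubnP (n.+1 - k); elim: j k qk => // j IHj k qk jk.
have [nk|kn] := ltnP n k; first
  by rewrite wt_sum_gt // cf_gt // -Em ltnS ltn_sub2r // (leq_ltn_trans qn).
have qn' : (q < n)%N by rewrite -subn_gt0 Em.
rewrite wt_sum_rec ?q0 ?qn' //; apply/eqP; rewrite subr_eq; apply/eqP.
have -> : \sum_(b < n | (0 < b)%N) a b * wt_sum z q (k + b) =
   \sum_(b < n | (0 < b)%N) a b * cf m.+2 ((k - q).+1 + b)%N.
  apply: eq_bigr => b b0; rewrite IHj; first by rewrite addSn -addnBAC.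
    by rewrite (leq_trans qk) // leq_addr.
  lia.
rewrite cf_rec; last by lia.
(* For k = q the zero block is too small to contain [q + 1] points, which matches the vanishing of
   the coefficient of w^0. *)
move: qk; rewrite leq_eqVlt => /orP[/eqP <-|qk].
  by rewrite wt_sum_lt ?ltnSn // subnn cf0.
rewrite IHm //; last by lia.
by rewrite -subSn // subSS.
Qed.

End Weights.

Local Open Scope ring_scope.

(** * Powers of the compositional inverse *)

Section InverseCoefficients.
Variables (R : comNzRingType) (g : fps R).
Hypotheses (g0 : g 0 = 0) (g1 : g 1 = 1).

Lemma cinv_truncX n : exists r, fps_trunc n (fps_cinv g) = r * 'X.
Proof. by apply: dvdX; apply: trunc0; apply: fps_cinv0. Qed.

Lemma cinv_exp_gt n N j : (N < j)%N -> (fps_trunc n (fps_cinv g) ^+ j)`_N = 0.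
Proof. by move=> Nj; have [r ->] := cinv_truncX n; rewrite exprMn coefMXn Nj. Qed.

(** Multiply g(w) = x by w^j and compare coefficients of x^(N+1), a degree below the truncation
    order. *)
Lemma cinv_exp_rec n N j : (N <= n)%N -> let w := fps_trunc n.+2 (fps_cinv g) in
  \sum_(b < n.+1) g b.+1 * (w ^+ (j.+1 + b))`_N.+1 = (w ^+ j)`_N.
Proof.
move=> Nn w; have w0 : w`_0 = 0 by apply: trunc0; apply: fps_cinv0.
have E : eqX n.+2 (fps_trunc n.+2 g \Po w) 'X.
  apply: (eqX_trans _ (@trunc_fpsX R n.+2)); rewrite -(fps_cinvK g0 g1).
  by apply: eqX_sym; apply: eqX_fps_comp; apply: fps_cinv0.
have := eqX_mul E (fun i _ => erefl (w ^+ j)`_i) (_ : N.+1 < n.+2)%N.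
rewrite coefXM /= => <- //.
rewrite /fps_trunc poly_def (raddf_sum (comp_poly _)) mulr_suml coef_sum /=.
rewrite [RHS]big_ord_recl comp_polyZ g0 scale0r mul0r coef0 add0r.
apply: eq_bigr => b _; rewrite comp_polyZ comp_Xn_poly -scalerAl coefZ -exprD.
by rewrite lift0 [(b.+1 + _)%N]addSnnS [(b + _)%N]addnC.
Qed.

End InverseCoefficients.

Section Summation.
Variables (R : comNzRingType) (a : nat -> R) (g : fps R) (n : nat).
Hypotheses (g0 : g 0 = 0) (g1 : g 1 = 1).
Hypothesis (ga : forall b : nat, (0 < b)%N -> g b.+1 = a b).

Lemma wt_sum_inverse (z : 'I_n.+1) k : (0 < k)%N ->
  wt_sum a z 1 k = (fps_trunc n.+2 (fps_cinv g) ^+ k)`_n.+1.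
Proof.
move=> k0; pose cf N j := (fps_trunc n.+2 (fps_cinv g) ^+ j)`_N.
rewrite (@wt_sum_coef _ _ _ _ cf) //= ?subn1 ?prednK // => [N j Nn|N j Nj||N].
- have /= := cinv_exp_rec (N := N) g0 g1 j Nn; rewrite /cf => <-.
  rewrite [RHS](bigD1 ord0) //= g1 mul1r addn0; congr (_ + _).
  by apply: eq_big => [b|b b0]; [rewrite lt0n|rewrite ga].
- exact: cinv_exp_gt.
- by rewrite /cf expr1 coef_trunc fps_cinv1.
by rewrite /cf expr0 coef1.
Qed.

End Summation.

(** * Summation over all base points *)

Section PointedSum.
Variables (R : comNzRingType) (a : nat -> R) (n : nat).
Variable z : {set 'I_n} * {set {set 'I_n}} -> 'I_n.
Hypothesis zP : forall p, p \in PNC n -> z p \in p.1.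

Lemma wt_rebase p (i : 'I_n) : p \in PNC n -> i \in p.1 -> wt a (z p) p = wt a i p.
Proof.
move=> pX ip; have zp := zP pX.
have [ZP [d _] _ nci] := (pointedP i p).1 pX.
have [_ _ _ ncz] := (pointedP (z p) p).1 pX.
rewrite /wt (@eq_chain_weight _ _ (adjacent i)) // => A B AP BP.
by apply/idP/idP; apply: (adjacent_rebase _ d ZP).
Qed.

(** Double counting of pairs of a partition and a point of its zero block; by [wt_rebase] that point
    may serve as base point. *)
Lemma sum_wt k : (0 < k)%N -> k%:R * (\sum_(p in PNC n | #|p.1| == k) wt a (z p) p)
  = \sum_(i < n) wt_sum a i 1 k.
Proof.
move=> k0; rewrite mulr_sumr.
rewrite (eq_bigr (fun p : {set 'I_n} * {set {set 'I_n}} =>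
  \sum_(i in p.1) wt a i p)) => [|p /andP[pX /eqP pk]].
  rewrite (exchange_big_dep predT) //=; apply: eq_bigr => i _; apply: eq_bigl => p.
  rewrite in_PNCinit (initialS (cpos_self i)) subUset sub1set.
  have -> : initial i 0 = set0 by apply/setP => j; rewrite !inE.
  by rewrite sub0set andbT; case: (p \in PNC n); rewrite //= andbC.
rewrite (eq_bigr (fun=> wt a (z p) p)) => [|i ip]; last by rewrite -wt_rebase.
by rewrite sumr_const pk mulr_natl.
Qed.

End PointedSum.

Theorem theorem5p8 (R : comUnitRingType)
    (natU : forall n : nat, (0 < n)%N -> (n%:R : R) \is a GRing.unit)
    (a c d : nat -> R) (u : pspair R)
    (ua : forall n : nat, (0 < n)%N -> (\val u).1 n.+1 = a n)
    (uc : forall n : nat, (0 < n)%N -> (\val u).2 n = c n / n%:R)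
    (ud : forall n : nat, (0 < n)%N -> (\val (u^-1)%g).2 n = d n / n%:R)
    (n : nat) (n_gt0 : (0 < n)%N)
    (z : {set 'I_n} * {set {set 'I_n}} -> 'I_n)
    (zP : forall p, p \in PNC n -> z p \in p.1) :
  d n = \sum_(p in PNC n)
          (-1) ^+ (1 + #|p.2|) * (Crel (adjacent_closure (z p) p.2) p.2)%:R
          * c #|p.1| * \prod_(B in p.2) a #|B|.
Proof.
have [g0 g1 h0] := pspairP u.
case: n n_gt0 z zP => // n n_gt0 z zP.
rewrite (eq_bigr (fun p : {set 'I_n.+1} * {set {set 'I_n.+1}} =>
  - (c #|p.1| * wt a (z p) p))) => [|p pX]; last first.
  have /(pointedP (z p)) pp := pX.
  rewrite (Crel_closure _ (pointed_blocks pp)) exprD expr1 /wt.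
  by rewrite mulN1r !mulNr; congr (- _); rewrite mulrCA !mulrA mulrAC.
(* The sign of [- h(w)] cancels the extra sign that the zero block contributes to |pi|. *)
rewrite sumrN -[d _](mulrVK (natU n.+1 n_gt0)) -ud // mulNr; congr (- _).
rewrite coef_comp_sum mulr_suml.
rewrite (partition_big (fun p : {set 'I_n.+1} * {set {set 'I_n.+1}} =>
  inord #|p.1| : 'I_n.+2) xpredT) //=.
apply: eq_bigr => k _.
have szE (p : {set 'I_n.+1} * {set {set 'I_n.+1}}) :
    (inord #|p.1| == k) = (#|p.1| == k :> nat).
  rewrite -val_eqE /= inordK // ltnS; have := max_card (mem p.1); by rewrite card_ord.
(* Both sides vanish for k = 0: h has no constant term, and the zero block contains its base
   point. *)
have [k0|k0] := posnP k.
  rewrite k0 h0 !mul0r big1 // => p /andP[pX]; rewrite szE k0 cards_eq0 => /eqP Z0.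
  by have := zP p pX; rewrite Z0 inE.
(* Multiplication by k cancels the denominator of the coefficient c_k / k on one side and brings the
   other side into the form of [sum_wt]. *)
have kU := natU k k0; apply: (mulrI kU).
rewrite uc // [_ * (\sum_(_ | _) _)](_ : _ =
  c k * (n.+1%:R * (fps_trunc n.+2 (fps_cinv (\val u).1) ^+ k)`_n.+1)); last first.
  rewrite (eq_bigl (fun p : {set 'I_n.+1} * {set {set 'I_n.+1}} =>
    (p \in PNC n.+1) && (#|p.1| == k :> nat))) => [|p]; last by rewrite szE.
  rewrite (eq_bigr (fun p : {set 'I_n.+1} * {set {set 'I_n.+1}} =>
    c k * wt a (z p) p)) => [|p /andP[_ /eqP->] //].
  rewrite -mulr_sumr mulrCA sum_wt //; congr (_ * _).
  rewrite (eq_bigr (fun=> (fps_trunc n.+2 (fps_cinv (\val u).1) ^+ k)`_n.+1)) => [|i _].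
    by rewrite sumr_const card_ord mulr_natl.
  exact: wt_sum_inverse.
rewrite [c k / _]mulrC !mulrA divrr // mul1r -!mulrA; congr (_ * _).
exact: mulrC.
Qed.
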